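(* Let $N\ge1$ be an integer, $m>1$ and $\sigma_0:=\frac{N(m-1)}{m+1}$. For $\sigma\in[0,\sigma_0]$, there is no non-trivial stationary solution to the equation $$\partial_s v=\Delta v^m-|x|^\sigma v^m+v,\qquad (s,x)\in(0,\infty)\times\mathbb{R}^N,$$ belonging to $\mathcal{X}$.
   Context: $\dot H^1(\mathbb{R}^N)$ is the closure of $C_c^\infty(\mathbb{R}^N)$ for $\|\nabla z\|_2$, $L^2_\sigma(\mathbb{R}^N):=L^2(\mathbb{R}^N,|x|^\sigma dx)$ and $\mathcal{X}:=\{z\in L^{m+1}(\mathbb{R}^N): |z|^{m-1}z\in\dot H^1(\mathbb{R}^N)\cap L^2_\sigma(\mathbb{R}^N)\}$. Here $v^m$ is understood as $|v|^{m-1}v$. A stationary solution $v\in\mathcal{X}$ is a weak solution of $-\Delta v^m+|x|^\sigma v^m=v$ in $\mathbb{R}^N$, that is, $\int[\nabla v^m\cdot\nabla\vartheta+|x|^\sigma v^m\vartheta]dx=\int v\vartheta\,dx$ for all $\vartheta\in C_c^\infty(\mathbb{R}^N)$. Non-trivial means not a.e. equal to $0$. *)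

(* Defs.v *)
From HB Require Import structures.
From mathcomp Require Import all_boot all_order all_algebra.
From mathcomp Require Import all_classical all_reals all_analysis.

Set Implicit Arguments.
Unset Strict Implicit.
Unset Printing Implicit Defensive.
Import Order.TTheory GRing.Theory Num.Def Num.Theory.
Import numFieldNormedType.Exports.

Local Open Scope classical_set_scope.
Local Open Scope ring_scope.

(* Product (= Borel) sigma-algebra on R^n = 'rV[R]_n, generated by the
   coordinate functions, as the library does for n.-tuple R. *)
Definition rV_display : measure_display.
Proof. exact: default_measure_display. Qed.

Section measurable_rV.
Context {R : realType}.
Variable n : nat.

Let coors : 'I_n -> 'rV[R]_n -> measurableTypeR R := fun i x => x ord0 i.

Let rV_set0 : g_sigma_preimage coors set0.
Proof. exact: sigma_algebra0. Qed.

Let rV_setC A : g_sigma_preimage coors A -> g_sigma_preimage coors (~` A).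
Proof. exact: sigma_algebraC. Qed.

Let rV_bigcup (F : _^nat) : (forall i, g_sigma_preimage coors (F i)) ->
  g_sigma_preimage coors (\bigcup_i (F i)).
Proof. exact: sigma_algebra_bigcup. Qed.

HB.instance Definition _ := @isMeasurable.Build rV_display
  'rV[R]_n (g_sigma_preimage coors) rV_set0 rV_setC rV_bigcup.

End measurable_rV.

Section measurable_rV_lemmas.
Context {R : realType}.

Lemma measurable_coord n (i : 'I_n) :
  measurable_fun [set: 'rV[R]_n] (fun x : 'rV[R]_n => x ord0 i).
Proof.
move=> _ Y mY; rewrite setTI; apply: sub_sigma_algebra => /=.
rewrite -bigcup_seq/=; exists i => /=; first by rewrite mem_index_enum.
by exists Y => //; rewrite setTI.
Qed.

Lemma measurable_fun_coordP d (T : measurableType d) n (f : T -> 'rV[R]_n) :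
  (forall i, measurable_fun [set: T] (fun x => f x ord0 i)) ->
  measurable_fun [set: T] f.
Proof.
move=> mf _ A mA; rewrite setTI.
pose G := [set B : set 'rV[R]_n | measurable (f @^-1` B)].
suff : measurable `<=` G by exact.
apply: smallest_sub.
  split=> [|B GB|F GF]; rewrite /G/=.
  - by rewrite preimage_set0.
  - by rewrite setTD preimage_setC; exact: measurableC.
  - by rewrite preimage_bigcup; apply: bigcupT_measurable.
rewrite -bigcup_seq => B [i _] [C mC <-]; rewrite /G/= setTI.
by have := mf i measurableT C mC; rewrite setTI.
Qed.

Definition rV_cons n (p : measurableTypeR R * 'rV[R]_n) : 'rV[R]_n.+1 :=
  row_mx (p.1 : R)%:M p.2.

Definition rV_uncons n (x : 'rV[R]_n.+1) : measurableTypeR R * 'rV[R]_n :=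
  (x ord0 ord0, \row_i x ord0 (lift ord0 i)).

Lemma rV_cons0 n p : @rV_cons n p ord0 ord0 = p.1.
Proof.
have e : (ord0 : 'I_n.+1) = lshift n (ord0 : 'I_1) by exact/val_inj.
by rewrite e; apply: etrans (row_mxEl _ _ _ _) _; rewrite mxE eqxx mulr1n.
Qed.

Lemma rV_consS n p i : @rV_cons n p ord0 (lift ord0 i) = p.2 ord0 i.
Proof.
have e : lift ord0 i = rshift 1 i :> 'I_n.+1 by exact/val_inj.
by rewrite e; exact: (row_mxEr (p.1 : R)%:M p.2 ord0 i).
Qed.

Lemma rV_consK n : cancel (@rV_cons n) (@rV_uncons n).
Proof.
move=> [a t]; rewrite /rV_uncons rV_cons0/=; congr pair.
by apply/rowP => i; rewrite mxE rV_consS.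
Qed.

Lemma rV_unconsK n : cancel (@rV_uncons n) (@rV_cons n).
Proof.
move=> x; apply/rowP => i; case: (unliftP ord0 i) => [j|] ->.
  by rewrite rV_consS mxE.
by rewrite rV_cons0.
Qed.

Lemma measurable_rV_cons n : measurable_fun setT (@rV_cons n).
Proof.
apply: measurable_fun_coordP => i; case: (unliftP ord0 i) => [j|] ->.
  under eq_fun do rewrite rV_consS.
  exact: measurableT_comp (measurable_coord j) measurable_snd.
under eq_fun do rewrite rV_cons0.
exact: measurable_fst.
Qed.

Lemma measurable_rV_uncons n : measurable_fun setT (@rV_uncons n).
Proof.
apply/measurable_fun_pairP; split; first exact: measurable_coord.
apply: measurable_fun_coordP => i.
rewrite (_ : (fun _ => _) = (fun x : 'rV[R]_n.+1 => x ord0 (lift ord0 i))).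
  exact: measurable_coord.
by apply/funext => x; rewrite /= mxE.
Qed.

End measurable_rV_lemmas.

Section lebesgue_rV_succ.
Context {R : realType} (n : nat).
Variable mu : {sigma_finite_measure set 'rV[R]_n -> \bar R}.
Local Open Scope ereal_scope.

Definition lebesgue_rV_succ : set 'rV[R]_n.+1 -> \bar R :=
  pushforward (@lebesgue_measure R \x mu) (@rV_cons R n).

Let succ0 : lebesgue_rV_succ set0 = 0.
Proof. by rewrite /lebesgue_rV_succ /pushforward preimage_set0 measure0. Qed.

Let succ_ge0 A : 0 <= lebesgue_rV_succ A.
Proof. by rewrite /lebesgue_rV_succ /pushforward; exact: measure_ge0. Qed.

Let succ_sigma_additive : semi_sigma_additive lebesgue_rV_succ.
Proof.
move=> F mF tF mUF; rewrite /lebesgue_rV_succ /pushforward preimage_bigcup.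
have mc A : measurable A -> measurable (@rV_cons R n @^-1` A).
  by move=> mA; rewrite -[X in measurable X]setTI; exact: measurable_rV_cons.
apply: measure_semi_sigma_additive.
- by move=> i; apply: mc; exact: mF.
- apply/trivIsetP => /= i j _ _ ij; rewrite -preimage_setI.
  by move/trivIsetP : tF => /(_ _ _ _ _ ij) ->//; rewrite preimage_set0.
- by rewrite -preimage_bigcup; exact: mc.
Qed.

HB.instance Definition _ := isMeasure.Build _ _ _ lebesgue_rV_succ
  succ0 succ_ge0 succ_sigma_additive.

Let succ_sigma_finite : sigma_finite setT lebesgue_rV_succ.
Proof.
have [F TF mF] : sigma_finite setT (@lebesgue_measure R \x mu).
  have /sigma_finiteP[A [TA ndA Aoo]] := sigma_finiteT (@lebesgue_measure R).
  have /sigma_finiteP[B [TB ndB Boo]] := sigma_finiteT mu.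
  exists (fun k => A k `*` B k).
    rewrite -setXTT TA TB predeqE => -[x y]; split; last first.
      by move=> [k _ []/= ? ?]; split; exists k.
    move=> [/= [i _ Aix] [j _ Bjy]]; exists (maxn i j) => //; split.
    - by move: x Aix; exact/subsetPset/ndA/leq_maxl.
    - by move: y Bjy; exact/subsetPset/ndB/leq_maxr.
  move=> k; have [? ?] := Aoo k; have [? ?] := Boo k.
  split; first exact: measurableX.
  by rewrite product_measure1E// lte_mul_pinfty// ge0_fin_numE.
exists (fun k => @rV_uncons R n @^-1` F k).
  by rewrite -preimage_bigcup -TF preimage_setT.
move=> k; have [mFk Fk] := mF k; split.
  by rewrite -[X in measurable X]setTI; exact: measurable_rV_uncons.
rewrite /lebesgue_rV_succ /pushforward -comp_preimage.
rewrite (_ : _ \o _ = idfun); first by rewrite preimage_id.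
by apply/funext => p /=; rewrite rV_consK.
Qed.

HB.instance Definition _ := Measure_isSigmaFinite.Build _ _ _
  lebesgue_rV_succ succ_sigma_finite.

End lebesgue_rV_succ.

Fixpoint lebesgue_rV (R : realType) (n : nat) :
    {sigma_finite_measure set 'rV[R]_n -> \bar R} :=
  match n with
  | 0 => \d_ (0 : 'rV[R]_0)
  | n'.+1 => lebesgue_rV_succ (lebesgue_rV R n')
  end.

Lemma lebesgue_rV_box (R : realType) (n : nat) (A : 'I_n -> set R) :
  (forall i, measurable (A i : set (measurableTypeR R))) ->
  (lebesgue_rV R n [set x : 'rV[R]_n | forall i, A i (x ord0 i)] =
   \prod_(i < n) lebesgue_measure (A i))%E.
Proof.
elim: n A => [|n IH] A mA /=.
  rewrite big_ord0 diracE (_ : (0 \in _) = true)//.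
  by apply/mem_set => -[].
rewrite /lebesgue_rV_succ /pushforward big_ord_recl -IH//.
rewrite -product_measure1E//; last first.
  rewrite (_ : mkset _ = \bigcap_(i in [set: 'I_n])
      ((fun x : 'rV[R]_n => x ord0 i) @^-1` A (lift ord0 i))).
    apply: fin_bigcap_measurable => // i _.
    have := measurable_coord i measurableT (mA (lift ord0 i)).
    by rewrite setTI.
  by apply/seteqP; split => x /= h i; [move=> _|]; exact: h.
congr (_ _); apply/seteqP; split => -[a t] /=.
  move=> h; split => /= [|i]; first by have := h ord0; rewrite rV_cons0.
  by have := h (lift ord0 i); rewrite rV_consS.
move=> [h0 hS] i; case: (unliftP ord0 i) => [j|] ->.
  by rewrite rV_consS; exact: hS.
by rewrite rV_cons0.
Qed.

Section function_spaces.
Context {R : realType} {N : nat}.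
Implicit Types (u v theta : 'rV[R]_N -> R) (G : 'rV[R]_N -> 'rV[R]_N).
Local Notation mu := (lebesgue_rV R N).

Definition dotp (x y : 'rV[R]_N) : R := \sum_i x ord0 i * y ord0 i.

(* The library norm `|x| on 'rV[R]_N is the sup norm, hence: *)
Definition enorm (x : 'rV[R]_N) : R := Num.sqrt (dotp x x).

Definition partial (i : 'I_N) u : 'rV[R]_N -> R :=
  fun x => 'D_(delta_mx ord0 i) u x.

Definition gradient u : 'rV[R]_N -> 'rV[R]_N := fun x => \row_i partial i u x.

(* C^infty: every iterated partial derivative exists and is continuous. *)
Definition smooth u := forall s : seq 'I_N,
  continuous (foldr partial u s) /\
  forall i x, derivable (foldr partial u s) x (delta_mx ord0 i).

Definition test_function theta :=
  smooth theta /\ compact (closure [set x | theta x != 0]).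

Definition locally_integrable_rV u := measurable_fun setT u /\
  forall K, compact K -> (\int[mu]_(x in K) `|u x|%:E < +oo)%E.

Definition weak_gradient u G := [/\ locally_integrable_rV u,
  forall i, locally_integrable_rV (fun x => G x ord0 i) &
  forall theta i, test_function theta ->
    \int[mu]_x (u x * partial i theta x) =
    - \int[mu]_x (G x ord0 i * theta x)].

(* Closure of the test functions for ||grad z||_2, realized as a space of
   functions: convergence of the gradients in L^2, together with convergence
   in L^1_loc. The latter fixes the additive constant that the seminorm does
   not see; for N >= 3 this gives the usual subspace of L^(2N/(N-2)), and for
   N = 1, 2 it is no restriction since there the constants are limits of
   test functions. *)
Definition Hdot1 : set ('rV[R]_N -> R) := [set u : 'rV[R]_N -> R | exists2 G,
  weak_gradient u G & finite_norm mu 2%:E (enorm \o G) /\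
  exists phi : nat -> 'rV[R]_N -> R, [/\ forall k, test_function (phi k),
    (fun k => 'N[mu]_2%:E[EFin \o (fun x => enorm (gradient (phi k) x - G x))])%E
      @ \oo --> 0%E &
    forall K, compact K ->
      (fun k => \int[mu]_(x in K) `|phi k x - u x|%:E)%E @ \oo --> 0%E]].

Definition L2_weighted (sigma : R) : set ('rV[R]_N -> R) := [set u : 'rV[R]_N -> R |
  measurable_fun setT u /\
  (\int[mu]_x (enorm x `^ sigma * `|u x| ^+ 2)%:E < +oo)%E].

Definition signed_pow (m : R) v : 'rV[R]_N -> R :=
  fun x => `|v x| `^ (m - 1) * v x.

Definition spaceX (m sigma : R) : set ('rV[R]_N -> R) := [set z : 'rV[R]_N -> R |
  z \in Lfun mu (m + 1)%:E /\
  (Hdot1 `&` L2_weighted sigma) (signed_pow m z)].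

Definition stationary_solution (m sigma : R) v :=
  spaceX m sigma v /\
  exists2 G, weak_gradient (signed_pow m v) G &
  forall theta, test_function theta ->
    \int[mu]_x (dotp (G x) (gradient theta x)
                + enorm x `^ sigma * signed_pow m v x * theta x) =
    \int[mu]_x (v x * theta x).

Definition nontrivial v := ~ {ae mu, forall x, v x = 0}.

End function_spaces.

Definition sigma0 {R : realType} (N : nat) (m : R) : R :=
  N%:R * (m - 1) / (m + 1).

(* Main.v *)
From HB Require Import structures.
Require Import Defs.
From mathcomp Require Import all_boot all_order all_algebra.
From mathcomp Require Import all_classical all_reals all_analysis measurable_realfun.
From mathcomp Require Import ring lra.
Import Order.TTheory GRing.Theory Num.Def Num.Theory.
Import numFieldNormedType.Exports.
Local Open Scope classical_set_scope.
Local Open Scope ring_scope.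

(** Put [w = |v|^(m-1) v], a weak solution of [- Laplacian w + |x|^sigma w = v],
and [A = int |grad w|^2], [B = int |x|^sigma w^2], [C = int |v|^(m+1)].
Testing the equation with [w] gives the energy identity [A + B = C]; testing
it with [x . grad w] gives the virial (Pohozaev) identity
[(N/2 - 1) A + (N + sigma)/2 B = N m/(m+1) C].  Eliminating [C],
[A (2 (m+1) + N (m-1)) = B (sigma (m+1) - N (m-1))],
and the right-hand side is nonpositive exactly because [sigma <= sigma0].
So [A = 0]: the function [w] agrees with all its translates and, being square
integrable, it vanishes.

The work is to justify the two tests when [w] has one weak derivative only.
Let [u_h] denote the translate [u (. + h e_i)].

The increment [w_h - w] is an admissible test function after multiplication
by a smooth compactly supported [psi] (lemma [weak_diff]).  Indeed [w] comes
with test functions [phi_k] whose gradients converge to that of [w] in L2, and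
although [phi_k] itself is only known to converge locally in L1, its increments
converge in L2, because [||u_h - u|| <= |h| ||d_i u||] and because this bound
is stable under local L1 limits ([norm_diff_test], [L2_lower_semicontinuity],
[shift_diff_approx]).

Dividing by [h] and letting [h] tend to 0 tests the equation with
[psi d_i w].  No second derivative appears, thanks to convexity: whenever [p]
is a subgradient, [p (u_h - u) <= e_h - e], so that after division by [h] the
limits for [h > 0] and [h < 0] give the two inequalities of the chain rule
[int psi p d_i u = - int (d_i psi) e] ([chain_rule]).  This is applied to
[e = |grad w|^2 / 2] ([stress_identity]) and to [e = m/(m+1) |v|^(m+1)], of
which [v] is a subgradient with respect to [w] ([potential_identity]).  In the
weight term the coefficient [|x|^sigma x_i eta] has no sign, and cutting it into
nonnegative parts would destroy its differentiability at the origin; but this term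
is quadratic and an exact expansion is available ([weight_identity]).  With
[psi = x_i eta(x/n)] and [n] tending to infinity, summing over [i] gives the virial identity.

Letting instead [h] tend to infinity in [weak_diff] makes the
translate [w_h] negligible on the support of [psi], which tests the equation with [psi w]
([local_energy]) and yields the energy identity.  The same device shows that a
square integrable function agreeing with its translates vanishes. *)

Set Implicit Arguments.
Unset Strict Implicit.
Unset Printing Implicit Defensive.

(** * Integrable and square integrable functions *)

Section L2.
Context d (T : measurableType d) (R : realType) (mu : {measure set T -> \bar R}).
Implicit Types (f g e : T -> R).

Definition integrableR f : Prop := mu.-integrable setT (EFin \o f).
Definition L2 f : Prop := measurable_fun setT f /\ integrableR (fun x => f x ^+ 2).

Lemma integrableR_measurable f : integrableR f -> measurable_fun setT f.
Proof. by move=> /measurable_int /measurable_EFinP. Qed.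

Lemma le_integrableR f g : measurable_fun setT f -> integrableR g ->
  (forall x, `|f x| <= g x) -> integrableR f.
Proof.
move=> mf ig fg; apply: (@le_integrable _ _ _ mu setT measurableT _ (EFin \o g)) => //.
  exact/measurable_EFinP.
by move=> x _ /=; rewrite lee_fin (le_trans (fg x)) ?ler_norm.
Qed.

Lemma integrableRD f g : integrableR f -> integrableR g -> integrableR (fun x => f x + g x).
Proof. by move=> fi gi; have := @integrableD _ _ _ mu setT measurableT _ _ fi gi. Qed.

Lemma integrableRB f g : integrableR f -> integrableR g -> integrableR (fun x => f x - g x).
Proof. by move=> fi gi; have := @integrableB _ _ _ mu setT measurableT _ _ fi gi. Qed.

Lemma integrableRZ c f : integrableR f -> integrableR (fun x => c * f x).
Proof. by move=> fi; have := @integrableZl _ _ _ mu setT measurableT c _ fi. Qed.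

Lemma integrableR0 : integrableR (fun=> 0).
Proof. exact: integrable0. Qed.

Lemma integrableR_sum (J : Type) (s : seq J) (F : J -> T -> R) :
  (forall j, integrableR (F j)) -> integrableR (fun x => \sum_(j <- s) F j x).
Proof.
move=> iF; elim: s => [|j s IH].
  under [X in integrableR X]eq_fun do rewrite big_nil; exact: integrableR0.
under [X in integrableR X]eq_fun do rewrite big_cons; exact: integrableRD.
Qed.

Lemma integrableR_Mbounded M f e : measurable_fun setT f -> (forall x, `|f x| <= M) ->
  integrableR e -> integrableR (fun x => f x * e x).
Proof.
move=> mf fM ie; apply: (@le_integrableR _ (fun x => M * `|e x|)).
- by apply: measurable_funM => //; exact: integrableR_measurable.
- by apply: integrableRZ; exact: (@integrable_norm _ _ _ mu setT).
- by move=> x; rewrite normrM ler_wpM2r.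
Qed.

Lemma Rint_add f g : integrableR f -> integrableR g ->
  \int[mu]_x (f x + g x) = \int[mu]_x f x + \int[mu]_x g x.
Proof. by move=> *; rewrite RintegralD. Qed.

Lemma Rint_sub f g : integrableR f -> integrableR g ->
  \int[mu]_x (f x - g x) = \int[mu]_x f x - \int[mu]_x g x.
Proof. by move=> *; rewrite RintegralB. Qed.

Lemma Rint_scale c f : integrableR f -> \int[mu]_x (c * f x) = c * \int[mu]_x f x.
Proof. by move=> *; rewrite RintegralZl. Qed.

Lemma Rint0 : \int[mu]_x (0 : R) = 0.
Proof. by rewrite /Rintegral integral0. Qed.

Lemma Rint_sum (J : Type) (s : seq J) (F : J -> T -> R) :
  (forall j, integrableR (F j)) ->
  \int[mu]_x (\sum_(j <- s) F j x) = \sum_(j <- s) \int[mu]_x F j x.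
Proof.
move=> iF; elim: s => [|j s IH].
  rewrite big_nil -[RHS]Rint0; apply: eq_Rintegral => x _; exact: big_nil.
rewrite big_cons -IH -Rint_add; last 2 first.
- exact: iF.
- exact: integrableR_sum.
by apply: eq_Rintegral => x _; rewrite big_cons.
Qed.

Lemma eq_Rint f g : f =1 g -> \int[mu]_x f x = \int[mu]_x g x.
Proof. by move=> fg; apply: eq_Rintegral => x _. Qed.

Lemma le_Rint f g : integrableR f -> integrableR g -> (forall x, f x <= g x) ->
  \int[mu]_x f x <= \int[mu]_x g x.
Proof. by move=> fi gi fg; apply: le_Rintegral => // x _. Qed.

Lemma Rint_ge0 f : (forall x, 0 <= f x) -> 0 <= \int[mu]_x f x.
Proof. by move=> f0; apply: Rintegral_ge0 => x _. Qed.

Lemma L2M f g : L2 f -> L2 g -> integrableR (fun x => f x * g x).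
Proof.
move=> [mf fi] [mg gi]; apply: (le_integrableR _ (integrableRD fi gi)).
  exact: measurable_funM.
move=> x; rewrite ler_norml; apply/andP; split.
  have := sqr_ge0 (f x + g x); have := sqr_ge0 (f x); have := sqr_ge0 (g x); nra.
have := sqr_ge0 (f x - g x); have := sqr_ge0 (f x); have := sqr_ge0 (g x); nra.
Qed.

Lemma L2Z c f : L2 f -> L2 (fun x => c * f x).
Proof.
move=> [mf fi]; split; first exact: measurable_funM.
by under [X in integrableR X]eq_fun do rewrite exprMn; exact: integrableRZ.
Qed.

Lemma L2D f g : L2 f -> L2 g -> L2 (fun x => f x + g x).
Proof.
move=> Lf Lg; have [mf fi] := Lf; have [mg gi] := Lg; split.
  exact: measurable_funD.
have -> : (fun x => (f x + g x) ^+ 2) =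
  (fun x => (f x ^+ 2 + g x ^+ 2) + 2 * (f x * g x)).
  by apply/funext => x; ring.
by apply: integrableRD; [exact: integrableRD|apply: integrableRZ; exact: L2M].
Qed.

Lemma L2B f g : L2 f -> L2 g -> L2 (fun x => f x - g x).
Proof.
move=> Lf /(L2Z (-1)) /(L2D Lf).
by congr L2; apply/funext => x; rewrite mulN1r.
Qed.

Lemma L2_Mbounded M f e : measurable_fun setT f -> (forall x, `|f x| <= M) ->
  L2 e -> L2 (fun x => f x * e x).
Proof.
move=> mf fM [me ie]; split; first exact: measurable_funM.
under [X in integrableR X]eq_fun do rewrite exprMn.
apply: (@integrableR_Mbounded (M ^+ 2)) => //; first exact: measurable_funX.
by move=> x; rewrite normrX lerXn2r ?nnegrE// (le_trans _ (fM x)).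
Qed.

Lemma sqr_norm_add_le f g : L2 f -> L2 g -> \int[mu]_x ((f x + g x) ^+ 2) <=
  2 * \int[mu]_x (f x ^+ 2) + 2 * \int[mu]_x (g x ^+ 2).
Proof.
move=> Lf Lg; have [_ fi] := Lf; have [_ gi] := Lg.
rewrite -!Rint_scale// -Rint_add; [|exact: integrableRZ|exact: integrableRZ]; apply: le_Rint.
- by have [] := L2D Lf Lg.
- by apply: integrableRD; exact: integrableRZ.
- by move=> x; have := sqr_ge0 (f x - g x); nra.
Qed.

Lemma cauchy_schwarz f g : L2 f -> L2 g ->
  (\int[mu]_x (f x * g x)) ^+ 2 <=
  \int[mu]_x (f x ^+ 2) * \int[mu]_x (g x ^+ 2).
Proof.
move=> Lf Lg; have [_ fi] := Lf; have [_ gi] := Lg; have fgi := L2M Lf Lg.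
set a := \int[mu]_x (f x ^+ 2); set b := \int[mu]_x (g x ^+ 2); set c := \int[mu]_x _.
have H t : 0 <= a * t ^+ 2 - 2 * t * c + b.
  have -> : a * t ^+ 2 - 2 * t * c + b = \int[mu]_x ((t * f x - g x) ^+ 2).
    rewrite (mulrC a) /a /b /c -!Rint_scale// -Rint_sub; [|exact: integrableRZ|exact:
        integrableRZ].
    rewrite -Rint_add//; last by apply: integrableRB; exact: integrableRZ.
    by apply: eq_Rint => x; ring.
  by apply: Rint_ge0 => x; exact: sqr_ge0.
have a0 : 0 <= a by apply: Rint_ge0 => x; exact: sqr_ge0.
have [a00|an0] := eqVneq a 0.
  rewrite a00 mul0r; have [->|c0] := eqVneq c 0; first by rewrite expr0n.
  have := H ((b + 1) / (2 * c)); rewrite a00.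
  have -> : 0 * ((b + 1) / (2 * c)) ^+ 2 - 2 * ((b + 1) / (2 * c)) * c + b = -1.
    by field.
  lra.
have {a0 an0}a0 : 0 < a by rewrite lt_neqAle eq_sym an0.
have := H (c / a).
have -> : a * (c / a) ^+ 2 - 2 * (c / a) * c + b = (a * b - c ^+ 2) / a.
  by field; rewrite gt_eqF.
by rewrite pmulr_lge0 ?invr_gt0// subr_ge0.
Qed.

Lemma cvg0_sqr (u v : R^nat) : (forall n, u n ^+ 2 <= v n) ->
  v @ \oo --> 0 -> u @ \oo --> 0.
Proof.
move=> uv v0.
have s0 : (fun n => Num.sqrt (v n)) @ \oo --> 0.
  by rewrite -[X in _ --> X]sqrtr0; apply: continuous_cvg => //; exact: sqrt_continuous.
apply: norm_cvg0; apply: (squeeze_cvgr _ (cvg_cst 0) s0).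
by near=> n; rewrite normr_ge0 /= -sqrtr_sqr ler_wsqrtr.
Unshelve. all: by end_near. Qed.

Lemma L2_pairing_cvg (f_ : (T -> R)^nat) f g : (forall n, L2 (f_ n)) -> L2 f -> L2 g ->
  (fun n => \int[mu]_x ((f_ n x - f x) ^+ 2)) @ \oo --> 0 ->
  (fun n => \int[mu]_x (f_ n x * g x)) @ \oo --> \int[mu]_x (f x * g x).
Proof.
move=> Lfn Lf Lg h; apply/subr_cvg0.
apply: (@cvg0_sqr _ (fun n => \int[mu]_x ((f_ n x - f x) ^+ 2) * \int[mu]_x (g x ^+ 2))).
  move=> n; rewrite /= -Rint_sub; [|exact: L2M|exact: L2M].
  rewrite (@eq_Rint _ (fun x => (f_ n x - f x) * g x)); last by move=> x; ring.
  by apply: cauchy_schwarz => //; exact: L2B.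
by rewrite -[X in _ --> X](mul0r (\int[mu]_x (g x ^+ 2))); apply: cvgMr_tmp.
Qed.

(** Dominated convergence in the form used throughout: the fixed integrable
factor dominates, and the bounded multipliers are cutoffs, difference quotients
of smooth functions or translated indicators. *)
Lemma cvg_bounded_multiplier M (f_ : (T -> R)^nat) f e :
  (forall n, measurable_fun setT (f_ n)) -> (forall n x, `|f_ n x| <= M) ->
  (forall x, f_ ^~ x @ \oo --> f x) -> integrableR e ->
  (fun n => \int[mu]_x (f_ n x * e x)) @ \oo --> \int[mu]_x (f x * e x).
Proof.
move=> mf fM ff ei.
have mfl : measurable_fun setT f by apply: measurable_fun_cvg => // x _; exact: ff.
have me := integrableR_measurable ei.
have fM' x : `|f x| <= M.
  by apply: (cvgr_to_le (cvg_norm (ff x))); apply: nearW => n; exact: fM.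
have [] := @dominated_convergence _ _ _ mu setT measurableT
  (fun n x => (f_ n x * e x)%:E) (fun x => (f x * e x)%:E) (fun x => (M * `|e x|)%:E).
- by move=> n; apply/measurable_EFinP; exact: measurable_funM.
- by apply/measurable_EFinP; exact: measurable_funM.
- by apply: aeW => x _; apply/cvg_EFin; [exact: nearW|apply: cvgMr_tmp; exact: ff].
- by apply: integrableRZ; exact: (@integrable_norm _ _ _ mu setT).
- by apply: aeW => x n _; rewrite /= lee_fin normrM ler_wpM2r.
move=> fi _; have ifin : (\int[mu]_x (f x * e x)%:E \is a fin_num)%E.
  exact: integrable_fin_num.
by rewrite -[X in _ --> X](fineK ifin); exact: fine_cvg.
Qed.

End L2.

(** * Lebesgue measure on row vectors: Borel sets and translations *)

Section rV_measure.
Context {R : realType}.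

Lemma coord_le_norm n (x : 'rV[R]_n) i : `|x ord0 i| <= `|x|.
Proof.
rewrite [leRHS]/normr /= mx_normrE; apply/bigmax_geP; right => /=.
by exists (ord0, i).
Qed.

Lemma norm_leP n (x : 'rV[R]_n) M : 0 <= M ->
  (forall i, `|x ord0 i| <= M) -> `|x| <= M.
Proof.
move=> M0 h; rewrite [leLHS]/normr /= mx_normrE; apply/bigmax_leP; split=> //.
by move=> [i j] _ /=; rewrite (ord1 i); exact: h.
Qed.

Lemma measurable_box n (A : 'I_n -> set R) :
  (forall i, measurable (A i : set (measurableTypeR R))) ->
  measurable [set x : 'rV[R]_n | forall i, A i (x ord0 i)].
Proof.
move=> mA; rewrite (_ : mkset _ = \bigcap_(i in [set: 'I_n])
      ((fun x : 'rV[R]_n => x ord0 i) @^-1` A i)).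
  apply: fin_bigcap_measurable => // i _.
  by have := measurable_coord i measurableT (mA i); rewrite setTI.
by apply/seteqP; split => x /= h i; [move=> _|]; exact: h.
Qed.

(** The sigma-algebra is generated by the coordinates, the topology by the sup
norm; they match because an open set is the union of the rational cubes that it
contains, and there are countably many of these. *)
Lemma open_measurable_rV n (A : set 'rV[R]_n) : open A -> measurable A.
Proof.
move=> oA.
(* [B (q, k)] is the open cube with center [q] and half-side [1/(k+1)]. *)
pose B (p : 'rV[rat]_n * nat) : set 'rV[R]_n :=
  [set x : 'rV[R]_n | forall i, ball (ratr (p.1 ord0 i) : R) (p.2.+1%:R^-1) (x ord0 i)].
have -> : A = \bigcup_(p in [set: 'rV[rat]_n * nat])
    (if `[< B p `<=` A >] then B p else set0).
  apply/seteqP; split => [x Ax|x [p _]]; last by case: asboolP => // h /h.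
  have [e /= e0 xe] : exists2 e : R, 0 < e & ball x e `<=` A.
    have /nbhs_ballP[e /= ? ?] : nbhs x A by exact: open_nbhs_nbhs.
    by exists e.
  have [k _ /(_ k (leqnn k)) /= ke] :=
    near_infty_natSinv_lt (PosNum (divr_gt0 e0 (ltr0Sn R 1))).
  have k0 : 0 < k.+1%:R^-1 :> R by rewrite invr_gt0.
  have /choice[q qx] : forall i : 'I_n, exists q : rat,
      ball (ratr q : R) (k.+1%:R^-1) (x ord0 i).
    move=> i; have /rat_in_itvoo[q] : x ord0 i < x ord0 i + k.+1%:R^-1.
      by rewrite ltrDl.
    rewrite in_itv/= => /andP[xq qx]; exists q.
    rewrite -ball_normE /ball_ /= ger0_norm; last by rewrite subr_ge0 ltW.
    by rewrite ltrBlDl.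
  exists (\row_i q i, k) => //.
  have [_|[]] := asboolP; first by move=> i; rewrite mxE; exact: qx.
  move=> y Bxy; apply: xe; rewrite -ball_normE /ball_ /=.
  apply: (@le_lt_trans _ _ (2 * k.+1%:R^-1)); last first.
    by rewrite mulrC -ltr_pdivlMr.
  apply: norm_leP => [|i]; first by rewrite mulr_ge0 // ltW.
  have := Bxy i; have := qx i; rewrite -!ball_normE /ball_ /= !mxE.
  move=> qxi qyi; rewrite -(subrKA (ratr (q i))) mulr_natl mulr2n.
  by rewrite (le_trans (ler_normD _ _))// lerD// ltW// distrC.
apply: countable_bigcupT_measurable => [|p]; first exact: countableP.
case: asboolP => // _; apply: (@measurable_box _ (fun i => ball (ratr (p.1 ord0 i) :
    R) (p.2.+1%:R^-1))) => i.
by apply: open_measurable; exact: ball_open.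
Qed.

Lemma measurable_continuous n (f : 'rV[R]_n -> R) :
  continuous f -> measurable_fun setT f.
Proof.
move=> /continuousP cf; apply: (measurability _ (RGenOpens.measurableE R)).
move=> _ [_ [a [b ->] <-]]; rewrite setTI; apply: open_measurable_rV.
exact/cf/interval_open.
Qed.

Lemma measurable_shift n (h : 'rV[R]_n) : measurable_fun setT (fun x : 'rV[R]_n => x + h :
    'rV[R]_n).
Proof.
apply: measurable_fun_coordP => i.
under eq_fun do rewrite mxE.
by apply: measurable_funD => //; exact: measurable_coord.
Qed.

Lemma measurable_addr (c : R) :
  measurable_fun setT (fun x : measurableTypeR R => x + c : measurableTypeR R).
Proof. exact: measurable_funD. Qed.

Lemma lebesgue_measure_shift (c : R) (A : set R) :
  measurable (A : set (measurableTypeR R)) ->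
  pushforward lebesgue_measure (fun x : measurableTypeR R => x + c : measurableTypeR R) A
   = lebesgue_measure A.
Proof.
move=> mA; have mc := measurable_addr c.
pose mf : {mfun measurableTypeR R >-> measurableTypeR R} := HB.pack (fun x :
    measurableTypeR R => x + c : measurableTypeR R) (isMeasurableFun.Build _ _ _ _ _ mc).
apply/esym; apply: (@lebesgue_measure_unique R (pushforward lebesgue_measure mf)) =>
    //= _ [[a b]] _ <-.
rewrite /pushforward.
rewrite (_ : _ @^-1` _ = `]a - c, b - c]%classic).
  rewrite !lebesgue_measure_itv/= !lte_fin ltrD2r.
  by case: ifP => // _; rewrite -!EFinB; congr EFin; ring.
apply/seteqP; split => x /=; rewrite !in_itv/=; lra.
Qed.

Lemma rV_consD n (a : R) (t : 'rV[R]_n) (h : 'rV[R]_n.+1) :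
  rV_cons (a, t) + h =
  rV_cons (a + h ord0 ord0, t + \row_i h ord0 (lift ord0 i)).
Proof.
apply/rowP => i; case: (unliftP ord0 i) => [j|] ->.
  have -> : forall u : 'rV[R]_n.+1, (u + h) ord0 (lift ord0 j) = u ord0 (lift ord0 j) + h ord0
      (lift ord0 j).
    by move=> u; rewrite mxE.
  by rewrite !rV_consS /= !mxE.
have -> : forall u : 'rV[R]_n.+1, (u + h) ord0 ord0 = u ord0 ord0 + h ord0 ord0.
  by move=> u; rewrite mxE.
by rewrite !rV_cons0.
Qed.

(** Induction on the dimension, by sections: translating the tail preserves the
measure of each section, and translating the first coordinate reduces to the
real line. *)
Lemma lebesgue_rV_shift n (h : 'rV[R]_n) (A : set 'rV[R]_n) : measurable A ->
  lebesgue_rV R n ((fun x : 'rV[R]_n => x + h : 'rV[R]_n) @^-1` A) = lebesgue_rV R n A.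
Proof.
elim: n h A => [|n IH] h A mA /=.
  congr (\d_ _ _); apply/seteqP; split => x /=.
    by rewrite (_ : x + h = x) //; apply/rowP => -[].
  by rewrite (_ : x + h = x) //; apply/rowP => -[].
have mshift := measurable_shift h.
have mA' : measurable ((fun x : 'rV[R]_n.+1 => x + h : 'rV[R]_n.+1) @^-1` A).
  by rewrite -[X in measurable X]setTI; exact: mshift.
have mc B : measurable B -> measurable (@rV_cons R n @^-1` B).
  by move=> mB; rewrite -[X in measurable X]setTI; exact: measurable_rV_cons.
rewrite /lebesgue_rV_succ /pushforward /product_measure1.
pose F (a : measurableTypeR R) := lebesgue_rV R n (xsection (@rV_cons R n @^-1` A) a).
transitivity (\int[@lebesgue_measure R]_a F ((a : R) + h ord0 ord0 : R)%R)%E.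
  apply: eq_integral => a _ /=; rewrite /F -[RHS](IH (\row_i h ord0 (lift ord0 i)));
    last by apply: measurable_xsection; exact: mc.
  congr (lebesgue_rV R n _); apply/seteqP; split => t /=; rewrite /xsection /= !inE /=.
    by rewrite rV_consD.
  by rewrite rV_consD.
have mF : measurable_fun setT F.
  by apply: measurable_fun_xsection; exact: mc.
rewrite -(@ge0_integral_pushforward _ _ _ _ R _ (measurable_addr (h ord0 ord0))
    lebesgue_measure setT F)//.
apply: eq_measure_integral => [|? B mB _]; first exact: measurable_addr.
exact: lebesgue_measure_shift.
Qed.

Variable n : nat.
Local Notation mu := (lebesgue_rV R n).
Implicit Types f : 'rV[R]_n -> R.

Lemma measurable_fun_shift (h : 'rV[R]_n) f : measurable_fun setT f ->
  measurable_fun setT (fun x : 'rV[R]_n => f (x + h)).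
Proof. by move=> mf; exact: (measurableT_comp mf (measurable_shift h)). Qed.

Lemma ge0_integral_shift (h : 'rV[R]_n) (f : 'rV[R]_n -> \bar R) : measurable_fun setT f ->
  (forall x, 0 <= f x)%E ->
  (\int[mu]_x f ((x : 'rV[R]_n) + h)%R = \int[mu]_x f x)%E.
Proof.
move=> mf f0.
rewrite -(@ge0_integral_pushforward _ _ _ _ R (fun x : 'rV[R]_n => x + h :
    'rV[R]_n) (measurable_shift h) mu setT f)//.
by apply: eq_measure_integral => [|? B mB _]; [exact: measurable_shift|exact:
    lebesgue_rV_shift].
Qed.

Lemma integrableR_shift (h : 'rV[R]_n) f : integrableR mu f -> integrableR mu (fun x :
    'rV[R]_n => f (x + h)).
Proof.
move=> fi; have mf := integrableR_measurable fi; move/integrableP : fi => [_ fi].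
apply/integrableP; split; first by apply/measurable_EFinP; exact: measurable_fun_shift.
rewrite (ge0_integral_shift h (f := fun x => `|(EFin \o f) x|%E))//.
by apply: measurableT_comp => //; exact/measurable_EFinP.
Qed.

Lemma Rint_shift (h : 'rV[R]_n) f : integrableR mu f -> \int[mu]_x f ((x :
    'rV[R]_n) + h) = \int[mu]_x f x.
Proof.
move=> fi; have mf := integrableR_measurable fi; rewrite /Rintegral; congr fine.
rewrite -(@integral_pushforward _ _ _ _ R (fun x : 'rV[R]_n => x + h :
    'rV[R]_n) (measurable_shift h) mu setT (EFin \o f))//.
- by apply: eq_measure_integral => [|? B mB _]; [exact: measurable_shift|exact:
    lebesgue_rV_shift].
- exact/measurable_EFinP.
- exact: (integrableR_shift h fi).
Qed.

Lemma L2_shift (h : 'rV[R]_n) f : L2 mu f -> L2 mu (fun x : 'rV[R]_n => f (x + h)).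
Proof.
by move=> [mf fi]; split; [exact: measurable_fun_shift|exact: (integrableR_shift h fi)].
Qed.

End rV_measure.

(** * Smooth functions *)

Section smooth_functions.
Context {R : realType} {N : nat}.
Local Notation V := 'rV[R]_N.
Implicit Types (u v : V -> R) (i j : 'I_N).

Definition unit_vec i : V := delta_mx ord0 i.

Lemma smooth_continuous u : smooth u -> continuous u.
Proof. by move=> /(_ [::])[]. Qed.

Lemma smooth_derivable u i x : smooth u -> derivable u x (unit_vec i).
Proof. by move=> /(_ [::])[_]; exact. Qed.

Lemma smooth_partial u i : smooth u -> smooth (partial i u).
Proof. by move=> su s; have := su (rcons s i); rewrite foldr_rcons. Qed.

(** To prove smoothness it is enough to exhibit a class of continuous
differentiable functions stable under partial derivatives; this avoids any formula
for iterated derivatives. *)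
Lemma smooth_ind (P : (V -> R) -> Prop) :
  (forall u, P u -> continuous u) ->
  (forall u i x, P u -> derivable u x (unit_vec i)) ->
  (forall u i, P u -> P (partial i u)) ->
  forall u, P u -> smooth u.
Proof.
move=> Pc Pd Pp u Pu s; suff : P (foldr partial u s).
  by move=> h; split; [exact: Pc|move=> i x; exact: Pd].
by elim: s => //= i s; exact: Pp.
Qed.

(** Sums of products of smooth functions form a class stable under partial
derivatives, by the Leibniz rule. *)
Inductive alg_closure : (V -> R) -> Prop :=
| alg_smooth u : smooth u -> alg_closure u
| alg_add u v : alg_closure u -> alg_closure v -> alg_closure (u + v)
| alg_mul u v : alg_closure u -> alg_closure v -> alg_closure (u * v).

Lemma alg_closure_smooth u : alg_closure u -> smooth u.
Proof.
have Pd : forall u, alg_closure u -> forall i x, derivable u x (unit_vec i).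
  move=> {}u; elim=> {u} [u su|u v _ IHu _ IHv|u v _ IHu _ IHv] i x.
  - exact: smooth_derivable.
  - exact: derivableD.
  - exact: derivableM.
move: u; apply: smooth_ind => [u|u i x Pu|u i].
- elim=> {u} [u|u v _ IHu _ IHv|u v _ IHu _ IHv].
  + exact: smooth_continuous.
  + by move=> x; exact: continuousD (IHu x) (IHv x).
  + by move=> x; exact: continuousM (IHu x) (IHv x).
- exact: Pd.
elim=> {u} [u su|u v Pu IHu Pv IHv|u v Pu IHu Pv IHv].
- by apply: alg_smooth; exact: smooth_partial.
- have -> : partial i (u + v) = partial i u + partial i v.
    by apply/funext => x; rewrite /partial deriveD//; exact: Pd.
  exact: alg_add.
- have -> : partial i (u * v) = u * partial i v + v * partial i u.
    by apply/funext => x; rewrite /partial deriveM//; exact: Pd.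
  by apply: alg_add; exact: alg_mul.
Qed.

Lemma smoothD u v : smooth u -> smooth v -> smooth (fun x => u x + v x).
Proof. by move=> su sv; apply/alg_closure_smooth/alg_add; exact: alg_smooth. Qed.

Lemma smoothM u v : smooth u -> smooth v -> smooth (fun x => u x * v x).
Proof. by move=> su sv; apply/alg_closure_smooth/alg_mul; exact: alg_smooth. Qed.

Lemma partialM u v i x : derivable u x (unit_vec i) -> derivable v x (unit_vec i) ->
  partial i (fun x => u x * v x) x = u x * partial i v x + v x * partial i u x.
Proof. by move=> du dv; exact: deriveM. Qed.

Lemma is_derive_coord (x w : V) j :
  is_derive x w (fun y : V => y ord0 j) (w ord0 j).
Proof.
have h : (fun h => h^-1 *: (((fun y : V => y ord0 j) \o shift x) (h *: w) - x ord0 j))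
    @ 0^' --> w ord0 j.
  apply: (@cvg_trans _ ((fun=> w ord0 j) @ (0 : R)^')); last exact: cvg_cst.
  apply: near_eq_cvg; near=> h => /=.
  rewrite !mxE addrK scalerA mulVf ?scale1r//.
  by near: h; exact: nbhs_dnbhs_neq.
split; first by apply/cvg_ex; exists (w ord0 j).
exact: cvg_lim.
Unshelve. all: by end_near. Qed.

Lemma smooth_coord (a b : R) j : smooth (fun x : V => a * x ord0 j + b).
Proof.
apply: (@smooth_ind (fun u => exists a b, u = fun x : V => a * x ord0 j + b));
  last by exists a, b.
- move=> _ [c [e ->]] x.
  apply: (@continuousD _ _ _ (fun x : V => c * x ord0 j) (fun=> e)); last exact:
      cst_continuous.
  by apply: (@continuousM _ _ (fun=> c)); [exact: cst_continuous|exact: coord_continuous].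
- move=> _ i x [c [e ->]]; apply: derivableD; last exact: derivable_cst.
  apply: (@derivableM _ _ (fun=> c)); first exact: derivable_cst.
  exact: (@ex_derive _ _ _ _ _ _ _ (is_derive_coord x (unit_vec i) j)).
- move=> _ i [c [e ->]]; exists 0, (c * (unit_vec i) ord0 j); apply/funext => x.
  have dc := is_derive_coord x (unit_vec i) j.
  rewrite mul0r add0r; apply: etrans.
    apply: (@deriveD _ _ _ (fun x : V => c * x ord0 j) (fun=> e)).
      by apply: (@derivableM _ _ (fun=> c)); [exact: derivable_cst|exact: ex_derive].
    exact: derivable_cst.
  rewrite derive_cst addr0; apply: etrans.
    by apply: (@deriveM _ _ (fun=> c)); [exact: derivable_cst|exact: ex_derive].
  by rewrite derive_cst scaler0 addr0 derive_val.
Qed.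

Lemma smooth_cst (c : R) : smooth (fun _ : V => c).
Proof.
apply: (@smooth_ind (fun u => exists c, u = fun=> c)); last by exists c.
- by move=> _ [b ->]; exact: cst_continuous.
- by move=> _ i x [b ->]; exact: derivable_cst.
- by move=> _ i [b ->]; exists 0; apply/funext => x; exact: derive_cst.
Qed.

Lemma is_derive_slice u (w x : V) (s : R) : derivable u (s *: w + x) w ->
  is_derive s 1 (fun t : R => u (t *: w + x)) ('D_w u (s *: w + x)).
Proof.
have E : (fun h : R => h^-1 *: (((fun t : R => u (t *: w + x)) \o shift s) (h *: 1)
    - u (s *: w + x))) =
  (fun h : R => h^-1 *: ((u \o shift (s *: w + x)) (h *: w) - u (s *: w + x))).
  by apply/funext => h /=; rewrite [h *: 1]mulr1 scalerDl addrA.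
move=> du; split; first by rewrite /derivable E.
by rewrite /derive E.
Qed.

Lemma is_derive_affine u (w x a : V) (c : R) : derivable u (c *: x + a) w ->
  is_derive x w (fun y => u (c *: y + a)) (c * 'D_w u (c *: x + a)).
Proof.
move=> du; set g := fun y => u (c *: y + a).
have E : (fun h : R => g (h *: w + x)) =
    (fun t : R => u (t *: w + (c *: x + a))) \o (fun h : R => c * h).
  by apply/funext => h /=; rewrite /g scalerDr scalerA addrA.
have d0 : is_derive (0 : R) 1 (fun h : R => g (h *: w + x)) (c * 'D_w u (c *: x + a)).
  rewrite E; have -> : c * 'D_w u (c *: x + a) = 'D_w u (c *: x + a) * (c * 1).
    by rewrite mulr1 mulrC.
  have hc : is_derive (0 : R) 1 (fun h : R => c * h) (c * 1).
    exact: (@is_deriveZ _ _ _ (@id R) c (0 : R) (1 : R) (1 : R) (is_derive_id (0 : R) (1 :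
        R))).
  have hu : is_derive (c * 0) 1 (fun t : R => u (t *: w + (c *: x + a))) ('D_w u (c *: x + a)).
    rewrite -[X in 'D_w u X]add0r -(scale0r w) mulr0.
    by apply: is_derive_slice; rewrite scale0r add0r.
  exact: is_derive1_comp hu hc.
have [d1 e1] := d0; split; first exact: (proj2 (derivable1P g x w) d1).
rewrite -[RHS]e1 /derive; set F := (fun h => _); set G := (X in _ = lim (X @ _)).
suff -> : F = G by []; apply/funext => h; rewrite /F /G /=.
by rewrite !addr0 scale0r add0r [h *: 1]mulr1.
Qed.

Lemma smooth_affine u (c : R) (a : V) : smooth u ->
  smooth (fun x => u (c *: x + a)).
Proof.
move=> su; apply: (@smooth_ind (fun f => exists k v, smooth v /\
    f = fun x => k * v (c *: x + a))); last first.
- by exists 1, u; split => //; apply/funext => x; rewrite mul1r.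
- move=> _ i [k [v [sv ->]]]; exists (k * c), (partial i v); split.
    exact: smooth_partial.
  apply/funext => x; have dv := is_derive_affine (@smooth_derivable v i (c *: x + a) sv).
  apply: etrans.
    by apply: (@deriveM _ _ (fun=> k)); [exact: derivable_cst|exact: ex_derive].
  by rewrite derive_cst scaler0 addr0 derive_val [LHS]mulrA.
- move=> _ i x [k [v [sv ->]]]; apply: (@derivableM _ _ (fun=> k)).
    exact: derivable_cst.
  apply: (@ex_derive _ _ _ _ _ _ _ (is_derive_affine (@smooth_derivable v i _ sv))).
- move=> _ [k [v [sv ->]]] x.
  have ca : {for x, continuous (fun y : V => c *: y + a)}.
    apply: (@continuousD _ _ _ (fun y : V => c *: y) (fun=> a)).
      exact: scaler_continuous.
    exact: cst_continuous.
  have cv : {for x, continuous (v \o (fun y : V => c *: y + a))}.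
    by apply: continuous_comp => //; exact: smooth_continuous.
  by apply: (@continuousM _ _ (fun=> k)) => //; exact: cst_continuous.
Qed.

Lemma partial_affine u (c : R) (a : V) i x : derivable u (c *: x + a) (unit_vec i) ->
  partial i (fun x => u (c *: x + a)) x = c * partial i u (c *: x + a).
Proof. by move=> du; have [_] := is_derive_affine du. Qed.

End smooth_functions.

(** * Test functions *)

Section test_functions.
Context {R : realType} {N : nat}.
Local Notation V := 'rV[R]_N.
Local Notation mu := (lebesgue_rV R N).
Implicit Types (u v theta : V -> R) (i j : 'I_N).

Lemma closed_norm_le (M : R) : closed [set x : V | `|x| <= M].
Proof.
have := @closed_comp _ _ (fun x : V => `|x|) [set y : R | y <= M].
apply; last exact: closed_le.
by move=> x _; exact: norm_continuous.
Qed.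

Lemma compact_norm_le (M : R) : compact [set x : V | `|x| <= M].
Proof.
apply: bounded_closed_compact; last exact: closed_norm_le.
exists M; split; first exact: num_real.
move=> y My x /= xM; exact: le_trans xM (ltW My).
Qed.

Lemma measurable_norm_le (M : R) : measurable [set x : V | `|x| <= M].
Proof.
rewrite -[X in measurable X]setCK; apply: measurableC.
by apply: open_measurable_rV; apply: closed_openC; exact: closed_norm_le.
Qed.

(** Compactness of the support only means vanishing outside some cube, the
closed balls of the sup norm being compact. *)
Lemma test_functionP theta : test_function theta <->
  smooth theta /\ exists M, forall x, M < `|x| -> theta x = 0.
Proof.
split=> [[st ct]|[st [M hM]]]; split => //.
  have [M [_ /(_ (M + 1))]] := compact_bounded ct.
  rewrite ltrDl => /(_ ltr01) h; exists (M + 1) => x Mx.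
  apply/eqP/negP => /negP tx; have : `|x| <= M + 1 by apply: h; exact: subset_closure.
  by rewrite leNgt Mx.
apply: (subclosed_compact (@closed_closure _ _) (@compact_norm_le M)).
rewrite [X in _ `<=` X](closure_id _).1; last exact: closed_norm_le.
apply: closure_subset => x /= tx; rewrite leNgt; apply/negP => /hM t0.
by rewrite t0 eqxx in tx.
Qed.

Lemma test_smooth theta : test_function theta -> smooth theta.
Proof. by case. Qed.

Lemma test_support theta : test_function theta ->
  exists2 M, 0 < M & forall x, M < `|x| -> theta x = 0.
Proof.
move=> /test_functionP[_ [M hM]]; exists (Num.max M 1).
  by rewrite lt_max ltr01 orbT.
by move=> x; rewrite gt_max => /andP[/hM].
Qed.

Lemma test_mul u theta : smooth u -> test_function theta ->
  test_function (fun x => u x * theta x).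
Proof.
move=> su tt; apply/test_functionP; split.
  by apply: smoothM => //; exact: test_smooth.
by have [M _ hM] := test_support tt; exists M => x /hM ->; rewrite mulr0.
Qed.

Lemma test_add u v : test_function u -> test_function v ->
  test_function (fun x => u x + v x).
Proof.
move=> tu tv; apply/test_functionP; split.
  by apply: smoothD => //; exact: test_smooth.
have [M _ hM] := test_support tu; have [K _ hK] := test_support tv.
by exists (Num.max M K) => x; rewrite gt_max => /andP[/hM -> /hK ->]; rewrite addr0.
Qed.

Lemma test_scale (c : R) theta : test_function theta ->
  test_function (fun x => c * theta x).
Proof. by move=> tt; apply: test_mul => //; exact: smooth_cst. Qed.

Lemma test_sub u v : test_function u -> test_function v ->
  test_function (fun x => u x - v x).
Proof.
move=> tu /(test_scale (-1)) /(test_add tu).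
by under [X in test_function X]eq_fun do rewrite mulN1r.
Qed.

Lemma test_affine theta (c : R) (a : V) : c != 0 -> test_function theta ->
  test_function (fun x => theta (c *: x + a)).
Proof.
move=> c0 tt; apply/test_functionP; split.
  by apply: smooth_affine; exact: test_smooth.
have [M _ hM] := test_support tt; exists ((M + `|a|) / `|c|) => x.
rewrite ltr_pdivrMr ?normr_gt0// => h; apply: hM.
rewrite -(ltrD2r `|a|) (lt_le_trans h)// mulrC -normrZ.
by rewrite -{1}(addrK a (c *: x)) ler_normB.
Qed.

Lemma test_shift theta (a : V) : test_function theta ->
  test_function (fun x => theta (x + a)).
Proof.
move=> /(@test_affine _ 1 a (oner_neq0 _)).
by under [X in test_function X]eq_fun do rewrite scale1r.
Qed.

Lemma partial_support u i M : (forall x, M < `|x| -> u x = 0) ->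
  forall x, M < `|x| -> partial i u x = 0.
Proof.
move=> hM x Mx; rewrite /partial -(@derive_cst R V R 0 x (unit_vec i)).
apply: near_eq_derive; near=> y; apply: hM; near: y.
have := closed_openC (@closed_norm_le M) => oM.
have : nbhs x (~` [set x : V | `|x| <= M]).
  by apply: open_nbhs_nbhs; split => //=; apply/negP; rewrite -ltNge.
by apply: filterS => y /= /negP; rewrite -ltNge.
Unshelve. all: by end_near. Qed.

Lemma test_partial theta i : test_function theta -> test_function (partial i theta).
Proof.
move=> tt; apply/test_functionP; split.
  by apply: smooth_partial; exact: test_smooth.
by have [M _ hM] := test_support tt; exists M; exact: partial_support.
Qed.

Lemma test_bounded theta : test_function theta ->
  exists2 K, 0 < K & forall x, `|theta x| <= K.
Proof.
move=> tt; have [M M0 hM] := test_support tt.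
have := continuous_compact
  (continuous_subspaceT (smooth_continuous (test_smooth tt))) (@compact_norm_le M).
move=> /compact_bounded [K [_ /(_ (`|K| + 1))]].
rewrite (le_lt_trans (ler_norm K)) ?ltrDl// => /(_ isT) h.
have K0 : 0 < `|K| + 1 by rewrite ltr_wpDl.
exists (`|K| + 1) => // x; have [xM|Mx] := leP `|x| M.
  by apply: h; exists x.
by rewrite hM// normr0 ltW.
Qed.

Lemma test_measurable theta : test_function theta -> measurable_fun setT theta.
Proof.
by move=> tt; apply: measurable_continuous; apply: smooth_continuous; exact: test_smooth.
Qed.

Lemma lebesgue_rV_norm_le (M : R) : (mu [set x : V | (`|x| <= M)%R] < +oo)%E.
Proof.
have [M0|M0] := ltP M 0.
  rewrite (_ : mkset _ = set0) ?measure0//; apply/seteqP; split => x //= xM.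
  by have := le_lt_trans xM M0; rewrite normr_lt0.
rewrite (_ : mkset _ = [set x : V | forall i, `[- M, M]%classic (x ord0 i)]).
  rewrite (@lebesgue_rV_box _ _ (fun=> `[- M, M]%classic))// ltey_eq; apply/orP; left.
  apply: (big_ind (fun y : \bar R => y \is a fin_num)) => // [x y|i _].
    exact: fin_numM.
  by rewrite /= lebesgue_measure_itv/=; case: ifP.
apply/seteqP; split => x /= h.
  by move=> i; rewrite in_itv/= -ler_norml; exact: le_trans (coord_le_norm x i) h.
by apply: norm_leP => // i; have := h i; rewrite in_itv/= -ler_norml.
Qed.

Lemma integrableR_ball (M : R) : integrableR mu (\1_[set x : V | `|x| <= M]).
Proof.
apply/integrableP; split.
  by apply/measurable_EFinP; apply: measurable_indic; exact: measurable_norm_le.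
rewrite (_ : (fun x => _) = (fun x => (\1_[set x : V | `|x| <= M] x)%:E)).
  by rewrite integral_indic ?setIT//; [exact: lebesgue_rV_norm_le|exact: measurable_norm_le].
by apply/funext => x /=; rewrite ger0_norm.
Qed.

Lemma integrableR_bounded_support u (K M : R) : measurable_fun setT u ->
    (forall x, `|u x| <= K) ->
  (forall x, M < `|x| -> u x = 0) -> integrableR mu u.
Proof.
move=> mu' uK uM; have K0 : 0 <= K by exact: le_trans (uK 0).
apply: (@le_integrableR _ _ _ mu u (fun x => K * \1_[set x : V | `|x| <= M] x)) => //.
  by apply: integrableRZ; exact: integrableR_ball.
move=> x; rewrite indicE; have [xM|Mx] := leP `|x| M.
  by rewrite mem_set//= mulr1.
by rewrite uM// normr0 mulr_ge0.
Qed.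

Lemma integrableR_test theta : test_function theta -> integrableR mu theta.
Proof.
move=> tt; have mt := test_measurable tt; have [M M0 hM] := test_support tt.
by have [K K0 tK] := test_bounded tt; exact: integrableR_bounded_support tK hM.
Qed.

Lemma L2_test theta : test_function theta -> L2 mu theta.
Proof.
move=> tt; split; first exact: test_measurable.
under [X in integrableR _ X]eq_fun do rewrite expr2.
by apply: integrableR_test; apply: test_mul => //; exact: test_smooth.
Qed.

Lemma derivable_lipschitz u i (K h : R) (x : V) : (forall y, derivable u y (unit_vec i)) ->
  (forall y, `|partial i u y| <= K) ->
  `|u (x + h *: unit_vec i) - u x| <= K * `|h|.
Proof.
move=> du uK; pose g (t : R) := u (t *: unit_vec i + x).
have dg (t : R) : is_derive t (1 : R) g (partial i u (t *: unit_vec i + x)).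
  exact: is_derive_slice.
have cg : continuous g.
  by move=> t; apply/differentiable_continuous/derivable1_diffP; exact: ex_derive.
have E : u (x + h *: unit_vec i) - u x = g h - g 0.
  by rewrite /g scale0r add0r [x + _]addrC.
rewrite E; have [h0|h0] := leP 0 h.
  have [c _ ->] := MVT_segment h0 (fun t _ => dg t) (continuous_subspaceT cg).
  by rewrite subr0 normrM ler_wpM2r ?uK.
have [c _ e] := MVT_segment (ltW h0) (fun t _ => dg t) (continuous_subspaceT cg).
by rewrite distrC e sub0r normrM normrN ler_wpM2r ?uK.
Qed.

Lemma derivable_cvg_quot u i (h : R^nat) x : derivable u x (unit_vec i) ->
  (forall n, h n != 0) -> h @ \oo --> 0 ->
  (fun n => (h n)^-1 * (u (x + h n *: unit_vec i) - u x)) @ \oo --> partial i u x.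
Proof.
move=> du hn0 h0; have hd : h @ \oo --> (0 : R)^'.
  move=> A A0; have : \forall n \near \oo, (h n != 0 -> A (h n)) := h0 _ A0.
  by apply: filterS => n; apply.
have := cvg_comp _ _ hd du.
by apply: cvg_trans; apply: near_eq_cvg; near=> n => /=; rewrite [x + _]addrC.
Unshelve. all: by end_near. Qed.

End test_functions.

(** * Difference quotients of test functions *)

Section difference_quotients.
Context {R : realType} {N : nat}.
Local Notation V := 'rV[R]_N.
Local Notation mu := (lebesgue_rV R N).
Implicit Types (u v psi : V -> R) (i j : 'I_N).

(** Dominated convergence, the dominating function being a multiple of the
indicator of a cube containing all the supports. *)
Lemma cvg_bounded_support K M (f_ : (V -> R)^nat) f :
  (forall n, measurable_fun setT (f_ n)) -> (forall n x, `|f_ n x| <= K) ->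
  (forall n x, M < `|x| -> f_ n x = 0) -> (forall x, f_ ^~ x @ \oo --> f x) ->
  (fun n => \int[mu]_x f_ n x) @ \oo --> \int[mu]_x f x.
Proof.
move=> mf fK fM ff.
have h := cvg_bounded_multiplier mf fK ff (@integrableR_ball R N M).
have E g : (forall x, M < `|x| -> g x = 0) ->
    \int[mu]_x (g x * \1_[set x : V | `|x| <= M] x) = \int[mu]_x g x.
  move=> gM; apply: eq_Rint => x; rewrite indicE; have [xM|Mx] := leP `|x| M.
    by rewrite mem_set// mulr1.
  by rewrite gM// mul0r.
rewrite E in h; last first.
  move=> x Mx; have := ff x; rewrite (_ : f_ ^~ x = cst 0).
    by move=> /(cvg_lim (@Rhausdorff R)) <-; rewrite lim_cst.
  by apply/funext => n; exact: fM.
rewrite (_ : (fun n => \int[mu]_x f_ n x) = (fun n => \int[mu]_x (f_ n x * \1_[set x :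
    V | `|x| <= M] x)))//.
by apply/funext => n; apply/esym/E => x; exact: fM.
Qed.

Definition shift_diff i (h : R) u : V -> R := fun x => u (x + h *: unit_vec i) - u x.

Definition diff_quot i (h : R) u : V -> R := fun x => h^-1 * shift_diff i h u x.

Section quot_test.
Variables (psi : V -> R) (i : 'I_N) (h : R^nat) (H : R).
Hypothesis tpsi : test_function psi.
Hypothesis hn0 : forall n, h n != 0.
Hypothesis hH : forall n, `|h n| <= H.
Hypothesis h0 : h @ \oo --> 0.

Lemma diff_quot_cvg x : (fun n => diff_quot i (h n) psi x) @ \oo --> partial i psi x.
Proof.
by apply: derivable_cvg_quot => //; apply: smooth_derivable; exact: test_smooth.
Qed.

Lemma diff_quot_bounded : exists2 K, 0 < K &
  (forall x, `|partial i psi x| <= K) /\ (forall n x, `|diff_quot i (h n) psi x| <= K).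
Proof.
have [K K0 pK] := test_bounded (test_partial i tpsi); exists K => //; split => // n x.
rewrite /diff_quot /shift_diff normrM normfV ler_pdivrMl ?normr_gt0// mulrC.
by apply: derivable_lipschitz => // y; apply: smooth_derivable; exact: test_smooth.
Qed.

Lemma diff_quot_support : exists M, (forall x, M < `|x| -> partial i psi x = 0) /\
  (forall n x, M < `|x| -> diff_quot i (h n) psi x = 0).
Proof.
have [M M0 pM] := test_support tpsi; have [M' _ dM] := test_support (test_partial i tpsi).
exists (Num.max (M + H * `|unit_vec i : V|) M'); split => [x|n x].
  by rewrite gt_max => /andP[_]; exact: dM.
rewrite gt_max => /andP[Mx _]; rewrite /diff_quot /shift_diff !pM ?subrr ?mulr0//.
  apply: le_lt_trans Mx; rewrite lerDl mulr_ge0//.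
  exact: le_trans (hH 0).
rewrite -(ltrD2r (H * `|unit_vec i : V|)) (lt_le_trans Mx)//.
have := ler_normB (x + h n *: unit_vec i) (h n *: unit_vec i); rewrite addrK => /le_trans;
    apply.
by rewrite lerD2l normrZ ler_wpM2r.
Qed.

Lemma diff_quot_measurable n : measurable_fun setT (diff_quot i (h n) psi).
Proof.
apply: measurable_funM => //; apply: measurable_funB.
  by apply: measurable_fun_shift; exact: test_measurable.
exact: test_measurable.
Qed.

Lemma diff_quot_cvg_L2 : (fun n => \int[mu]_x ((diff_quot i (h n) psi x - partial i psi x) ^+
    2))
  @ \oo --> 0.
Proof.
have [K K0 [dK qK]] := diff_quot_bounded; have [M [dM qM]] := diff_quot_support.
rewrite -[X in _ --> X](@Rint0 _ _ _ mu).
apply: (@cvg_bounded_support ((K + K) ^+ 2) M).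
- move=> n; apply: measurable_funX; apply: measurable_funB.
    exact: diff_quot_measurable.
  by apply: test_measurable; exact: test_partial.
- move=> n x; have K2 : 0 <= K + K by rewrite addr_ge0 // ltW.
  rewrite normrX lerXn2r ?nnegrE//.
  exact: le_trans (ler_normB _ _) (lerD (qK n x) (dK x)).
- by move=> n x Mx; rewrite qM// dM// subr0 expr0n.
- move=> x; have : (fun n => diff_quot i (h n) psi x - partial i psi x) @ \oo --> 0.
    by apply/subr_cvg0; exact: diff_quot_cvg.
  by move=> c; rewrite -(mulr0 0); under eq_fun do rewrite expr2; exact: cvgM.
Qed.

Lemma diff_quot_cvg_norm : (fun n => \int[mu]_x (diff_quot i (h n) psi x ^+ 2))
  @ \oo --> \int[mu]_x (partial i psi x ^+ 2).
Proof.
have [K K0 [dK qK]] := diff_quot_bounded; have [M [dM qM]] := diff_quot_support.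
apply: (@cvg_bounded_support (K ^+ 2) M).
- by move=> n; apply: measurable_funX; exact: diff_quot_measurable.
- move=> n x; have K2 : 0 <= K by exact: ltW.
  by rewrite normrX lerXn2r ?nnegrE//.
- by move=> n x Mx; rewrite qM// expr0n.
- move=> x; under eq_fun do rewrite expr2; rewrite expr2.
  by apply: cvgM; exact: diff_quot_cvg.
Qed.

End quot_test.

Lemma L2_shift_diff u i (h : R) : L2 mu u -> L2 mu (shift_diff i h u).
Proof. by move=> Lu; apply: L2B => //; exact: L2_shift. Qed.

(** Telescoping [n+1] increments.  The inequality
[(a + b)^2 <= (1 + 1/n) a^2 + (1 + n) b^2] loses nothing when [a = n b], so that
the constant is the sharp one. *)
Lemma norm_diff_subdiv u i (h : R) n : L2 mu u ->
  \int[mu]_x ((u (x + (n.+1%:R * h) *: unit_vec i) - u x) ^+ 2) <=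
  n.+1%:R ^+ 2 * \int[mu]_x ((u (x + h *: unit_vec i) - u x) ^+ 2).
Proof.
move=> Lu; elim: n => [|n IH].
  by rewrite expr1n mul1r; under eq_Rintegral do rewrite mul1r.
have L1 := L2_shift_diff i h Lu; have Ln := L2_shift_diff i (n.+1%:R * h) Lu.
have Lf := L2_shift (h *: unit_vec i) Ln.
set a := \int[mu]_x ((u (x + h *: unit_vec i) - u x) ^+ 2) in IH *.
set b := n.+1%:R : R; have b0 : 0 < b by rewrite ltr0n.
have bE : n.+2%:R = b + 1 by rewrite -natr1.
rewrite bE.
apply: (@le_trans _ _ (\int[mu]_x ((1 + b^-1) *
     (u ((x + h *: unit_vec i) + (b * h) *: unit_vec i) - u (x + h *: unit_vec i)) ^+ 2
   + (1 + b) * (u (x + h *: unit_vec i) - u x) ^+ 2))).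
  apply: le_Rint.
  - by have [] := L2_shift_diff i ((b + 1) * h) Lu.
  - by apply: integrableRD; apply: integrableRZ; [case: Lf|case: L1].
  - move=> x; rewrite -addrA -scalerDl (_ : h + b * h = (b + 1) * h); last by ring.
    set p := u (x + _); set q := u (x + _); set r := u x.
    rewrite -(subrKA q p) -subr_ge0.
    have -> : (1 + b^-1) * (p - q) ^+ 2 + (1 + b) * (q - r) ^+ 2 -
       (p - q + (q - r)) ^+ 2 = b^-1 * (p - q - b * (q - r)) ^+ 2.
      by field; rewrite gt_eqF.
    by rewrite mulr_ge0 ?sqr_ge0// invr_ge0 ltW.
rewrite Rint_add; [|by apply: integrableRZ; case: Lf|by apply: integrableRZ; case: L1].
rewrite (Rint_scale _ (proj2 Lf)) (Rint_scale _ (proj2 L1)).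
rewrite (Rint_shift (h *: unit_vec i) (f := fun x => (u (x + (b * h) *:
    unit_vec i) - u x) ^+ 2)); last by case: Ln.
apply: (@le_trans _ _ ((1 + b^-1) * (b ^+ 2 * a) + (1 + b) * a)).
  by rewrite lerD2r ler_wpM2l// addr_ge0// invr_ge0 ltW.
rewrite le_eqVlt; apply/orP; left; apply/eqP; field; by rewrite gt_eqF.
Qed.

(** Cutting [h] into [n+1] equal steps bounds the increment by the norm of a
difference quotient whose step tends to 0, for every [n]. *)
Lemma norm_diff_test psi i (h : R) : test_function psi ->
  \int[mu]_x ((psi (x + h *: unit_vec i) - psi x) ^+ 2) <=
  h ^+ 2 * \int[mu]_x (partial i psi x ^+ 2).
Proof.
move=> tpsi; have [->|h0] := eqVneq h 0.
  rewrite expr0n mul0r -[leRHS](@Rint0 _ _ _ mu) le_eqVlt; apply/orP; left; apply/eqP.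
  by apply: eq_Rint => x; rewrite scale0r addr0 subrr expr0n.
pose k n : R := h / n.+1%:R.
have kn0 n : k n != 0 by rewrite /k mulf_neq0// invr_neq0.
have kh n : `|k n| <= `|h|.
  by rewrite /k normrM ler_piMr// normfV ger0_norm// invf_le1// ler1n.
have k0 : k @ \oo --> 0.
  rewrite -(mulr0 h); apply: cvgMl_tmp; exact: cvg_harmonic.
have c := @diff_quot_cvg_norm psi i k `|h| tpsi kn0 kh k0.
have c' : (fun n => h ^+ 2 * \int[mu]_x (diff_quot i (k n) psi x ^+ 2)) @ \oo -->
    h ^+ 2 * \int[mu]_x (partial i psi x ^+ 2) by exact: cvgMl_tmp c.
apply: (cvgr_to_ge c'); apply: nearW => n /=.
have -> : h = n.+1%:R * k n by rewrite /k mulrC divfK.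
apply: (le_trans (norm_diff_subdiv i (k n) n (L2_test tpsi))).
rewrite [(n.+1%:R * k n) ^+ 2]exprMn -[leRHS]mulrA ler_wpM2l ?sqr_ge0//.
rewrite -Rint_scale; last by rewrite /diff_quot /shift_diff;
    under [X in integrableR _ X]eq_fun do rewrite exprMn;
  apply: integrableRZ; case: (L2_shift_diff i (k n) (L2_test tpsi)).
rewrite le_eqVlt; apply/orP; left; apply/eqP; apply: eq_Rint => x.
by rewrite /diff_quot /shift_diff -exprMn mulrA mulfV ?mul1r.
Qed.

End difference_quotients.

(** * Lower semicontinuity of the L2 norm under local L1 convergence *)

Section lower_semicontinuity.
Context {R : realType} {N : nat}.
Local Notation V := 'rV[R]_N.
Local Notation mu := (lebesgue_rV R N).
Implicit Types (f g u v : V -> R) (i j : 'I_N).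

Local Notation "'B_ M" := [set x : V | `|x| <= M] (at level 8, M at level 2).

Lemma norm_Rint_le f : integrableR mu f ->
  ((`|\int[mu]_x f x|)%:E <= \int[mu]_x (`|f x|)%:E)%E.
Proof.
move=> fi; rewrite EFin_normr_Rintegral//.
by apply: le_abse_integral => //; exact: measurable_int fi.
Qed.

Lemma le_ge0_int (f g : V -> \bar R) : measurable_fun setT f -> measurable_fun setT g ->
  (forall x, 0 <= f x)%E -> (forall x, f x <= g x)%E ->
  (\int[mu]_x f x <= \int[mu]_x g x)%E.
Proof. by move=> mf mg f0 fg; apply: ge0_le_integral. Qed.

Lemma squeeze0e (u v : (\bar R)^nat) : (forall k, 0 <= u k <= v k)%E ->
  v @ \oo --> 0%E -> u @ \oo --> 0%E.
Proof.
move=> uv v0; apply: (@squeeze_cvge _ _ _ _ (cst 0%E) _ v) => //.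
  exact: nearW.
exact: cvg_cst.
Qed.

(** The indicator inside the integral, rather than a restricted domain of
integration, makes translations act by [ge0_integral_shift]. *)
Definition L1loc_cvg (f_ : (V -> R)^nat) f := forall M : R,
  (fun k => \int[mu]_x (`|f_ k x - f x| * \1_('B_M) x)%:E)%E @ \oo --> 0%E.

Lemma measurable_L1loc f g M : measurable_fun setT f -> measurable_fun setT g ->
  measurable_fun setT (fun x => (`|f x - g x| * \1_('B_M) x)%:E).
Proof.
move=> mf mg; apply/measurable_EFinP; apply: measurable_funM.
  by apply: measurableT_comp => //; exact: measurable_funB.
by apply: measurable_indic; exact: measurable_norm_le.
Qed.

Lemma L1loc_cvg_ge0 f g M x : (0 <= (`|f x - g x| * \1_('B_M) x)%:E)%E.
Proof. by rewrite lee_fin mulr_ge0. Qed.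

Lemma L1loc_cst g : L1loc_cvg (fun=> g) g.
Proof.
move=> M; rewrite (_ : (fun k => _) = fun=> 0%E); first exact: cvg_cst.
apply/funext => k; apply: integral0_eq => x _.
by rewrite subrr normr0 mul0r.
Qed.

Lemma L1loc_sub (f_ g_ : (V -> R)^nat) f g :
  (forall k, measurable_fun setT (f_ k)) -> (forall k, measurable_fun setT (g_ k)) ->
  measurable_fun setT f -> measurable_fun setT g ->
  L1loc_cvg f_ f -> L1loc_cvg g_ g ->
  L1loc_cvg (fun k x => f_ k x - g_ k x) (fun x => f x - g x).
Proof.
move=> mf_ mg_ mf mg cf cg M.
apply: (@squeeze0e _ (fun k => \int[mu]_x (`|f_ k x - f x| * \1_('B_M) x)%:E +
   \int[mu]_x (`|g_ k x - g x| * \1_('B_M) x)%:E)%E).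
- move=> k; rewrite integral_ge0 => [/=|x _]; last exact: mulr_ge0.
  have m1 := measurable_L1loc M (mf_ k) mf; have m2 := measurable_L1loc M (mg_ k) mg.
  have <- := ge0_integralD mu measurableT (fun x _ => L1loc_cvg_ge0 (f_ k) f M x) m1
    (fun x _ => L1loc_cvg_ge0 (g_ k) g M x) m2.
  apply: le_ge0_int.
  + by apply: measurable_L1loc; exact: measurable_funB.
  + exact: emeasurable_funD.
  + exact: L1loc_cvg_ge0.
  + move=> x; rewrite -EFinD lee_fin -mulrDl ler_wpM2r//.
    rewrite (_ : _ - _ = (f_ k x - f x) - (g_ k x - g x)); last by ring.
    exact: ler_normB.
- by rewrite -[X in _ --> X]adde0; apply: cvgeD.
Qed.

Lemma L1loc_shift (f_ : (V -> R)^nat) f (h : V) :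
  (forall k, measurable_fun setT (f_ k)) -> measurable_fun setT f ->
  L1loc_cvg f_ f -> L1loc_cvg (fun k x => f_ k (x + h)) (fun x => f (x + h)).
Proof.
move=> mf_ mf cf M; have c := cf (M + `|h|).
apply: (squeeze0e _ c) => k; rewrite integral_ge0 => [/=|x _]; last exact: mulr_ge0.
have mF := measurable_L1loc (M + `|h|) (mf_ k) mf.
rewrite -(@ge0_integral_shift _ _ h _ mF); last first.
  by move=> x; exact: L1loc_cvg_ge0.
apply: le_ge0_int.
- by apply: measurable_L1loc; exact: measurable_fun_shift.
- exact: (measurableT_comp mF (measurable_shift h)).
- exact: L1loc_cvg_ge0.
- move=> x; rewrite lee_fin ler_wpM2l// !indicE ler_nat.
  have [xM|] := boolP (x \in 'B_M) => //=; rewrite mem_set//=.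
  by move: xM; rewrite inE/= => xM; rewrite (le_trans (ler_normD _ _))// lerD2r.
Qed.

(** If [a] is a truncation of [f] then [2 a f_k - a^2 <= f_k^2]; the left side is
linear in [f_k] with a bounded compactly supported coefficient, so that it passes to
the limit, where it equals [a^2].  Monotone convergence removes the truncation. *)
Lemma L2_lower_semicontinuity (f_ : (V -> R)^nat) f (c_ : R^nat) c :
  (forall k, L2 mu (f_ k)) -> measurable_fun setT f -> L1loc_cvg f_ f ->
  (forall k, \int[mu]_x (f_ k x ^+ 2) <= c_ k) -> c_ @ \oo --> c ->
  L2 mu f /\ \int[mu]_x (f x ^+ 2) <= c.
Proof.
move=> Lf mf cf fc cc.
(* [a n] is [f] cut off outside the cube of half-side [n] and where it exceeds [n]. *)
pose A n := [set x : V | `|x| <= n%:R] `&` [set x : V | `|f x| <= n%:R].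
have mA n : measurable (A n).
  apply: measurableI; first exact: measurable_norm_le.
  have mnf : measurable_fun setT (fun x => `|f x|) by exact: measurableT_comp.
  have := mnf measurableT _ (@measurable_itv R `]-oo, n%:R]%R).
  by rewrite setTI (_ : _ @^-1` _ = [set x : V | `|f x| <= n%:R])//;
    apply/seteqP; split => x /=; rewrite in_itv.
pose a n x := f x * \1_(A n) x.
have ma n : measurable_fun setT (a n).
  by apply: measurable_funM => //; exact: measurable_indic.
have an n x : `|a n x| <= n%:R.
  rewrite /a indicE; case: (boolP (x \in A n)) => [|_]; last by rewrite mulr0 normr0.
  by rewrite inE => -[_ /=]; rewrite mulr1.
have aB n x : n%:R < `|x| -> a n x = 0.
  rewrite ltNge => /negP h; rewrite /a indicE memNset ?mulr0//.
  by case.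
have af n x : a n x * f x = a n x ^+ 2.
  by rewrite /a indicE; case: (x \in A n); rewrite ?mulr1 ?mulr0 ?mul0r ?expr2 ?mul0r.
have ia n : integrableR mu (a n) by apply: integrableR_bounded_support (aB n) => //.
have La n : L2 mu (a n).
  split => //; under [X in integrableR _ X]eq_fun do rewrite expr2.
  exact: integrableR_Mbounded (ma n) (an n) (ia n).
have lim1 n : (fun k => \int[mu]_x (a n x * f_ k x)) @ \oo --> \int[mu]_x (a n x ^+ 2).
  apply/subr_cvg0; apply: norm_cvg0.
  have : (fun k => (`|\int[mu]_x (a n x * f_ k x) - \int[mu]_x (a n x ^+ 2)|)%:E) @ \oo -->
      0%:E.
    have c0 : (fun k => (n%:R)%:E * \int[mu]_x (`|f_ k x - f x| * \1_('B_(n%:R)) x)%:E)%E @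
        \oo --> 0%E.
      by rewrite -[X in _ --> X](mule0 (n%:R)%:E); apply: cvgeZl.
    apply: (squeeze0e _ c0) => k; rewrite lee_fin normr_ge0 /=.
    rewrite -Rint_sub; [|exact: L2M|by case: (La n)].
    have iB : integrableR mu (fun x => a n x * f_ k x - a n x ^+ 2).
      by apply: integrableRB; [exact: L2M|case: (La n)].
    apply: (le_trans (norm_Rint_le iB)).
    rewrite -ge0_integralZl//; last by apply: measurable_L1loc => //; case: (Lf k).
    apply: le_ge0_int.
    - apply/measurable_EFinP/measurableT_comp => //; apply: measurable_funB.
        by apply: measurable_funM => //; case: (Lf k).
      exact: measurable_funX.
    - apply: emeasurable_funM => //; apply: measurable_L1loc => //; by case: (Lf k).
    - by move=> x.
    - move=> x; rewrite -EFinM lee_fin -af -mulrBr normrM mulrA.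
      rewrite indicE; have [xM|Mx] := leP `|x| n%:R.
        by rewrite mem_set//= mulr1 ler_wpM2r.
      by rewrite aB// normr0 mul0r mulr_ge0.
  exact: fine_cvg.
have Ia n : \int[mu]_x (a n x ^+ 2) <= c.
  have l2 : (fun k => 2 * \int[mu]_x (a n x * f_ k x) - \int[mu]_x (a n x ^+ 2)) @ \oo
     --> 2 * \int[mu]_x (a n x ^+ 2) - \int[mu]_x (a n x ^+ 2).
    by apply: cvgB; [exact: cvgMl_tmp|exact: cvg_cst].
  have -> : \int[mu]_x (a n x ^+ 2) = 2 * \int[mu]_x (a n x ^+ 2) - \int[mu]_x (a n x ^+ 2) by
      ring.
  apply: ler_cvg_to l2 cc _; apply: nearW => k; apply: le_trans (fc k).
  rewrite -Rint_scale; [|exact: L2M]; rewrite -Rint_sub; [|by apply: integrableRZ; exact: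
      L2M|by case: (La n)].
  apply: le_Rint.
  - by apply: integrableRB; [apply: integrableRZ; exact: L2M|case: (La n)].
  - by case: (Lf k).
  - by move=> x; have := sqr_ge0 (a n x - f_ k x); nra.
have mono x : {homo (fun n => ((a n x) ^+ 2)%:E) : n m / (n <= m)%N >-> (n <= m)%E}.
  move=> n m nm; rewrite lee_fin /a !exprMn ler_wpM2l ?sqr_ge0// !indicE.
  have [|_] := boolP (x \in A n); last by rewrite expr0n sqr_ge0.
  rewrite inE => -[/= h1 h2]; rewrite mem_set//; split => /=.
    by rewrite (le_trans h1)// ler_nat.
  by rewrite (le_trans h2)// ler_nat.
have alim x : limn (fun n => ((a n x) ^+ 2)%:E) = (f x ^+ 2)%:E.
  apply/cvg_lim => //; apply: cvg_near_cst.
  have [k _ hk] : \forall n \near \oo, Num.max `|x| `|f x| <= n%:R.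
    exact: nbhs_infty_ger.
  exists k => // n /hk; rewrite ge_max => /andP[h1 h2].
  by rewrite /a indicE mem_set ?mulr1.
have cm := @cvg_monotone_convergence _ _ _ mu setT measurableT (fun n x => ((a n x) ^+ 2)%:E)
  (fun n => proj2 (measurable_EFinP _ _) (measurable_funX 2 (ma n)))
  (fun n x _ => sqr_ge0 (a n x)) (fun x _ n m => mono x n m).
rewrite (eq_integral (fun x => (f x ^+ 2)%:E)) in cm; last by move=> x _; exact: alim.
have le : (\int[mu]_x (f x ^+ 2)%:E <= c%:E)%E.
  apply: (cvge_to_le cm); apply: nearW => n.
  have := Ia n; rewrite -lee_fin /Rintegral fineK//.
  by apply: integrable_fin_num => //; case: (La n).
have i2 : integrableR mu (fun x => f x ^+ 2).
  apply/integrableP; split; first by apply/measurable_EFinP; exact: measurable_funX.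
  rewrite (eq_integral (fun x => (f x ^+ 2)%:E)) ?(le_lt_trans le) ?ltry//.
  by move=> x _ /=; rewrite ger0_norm ?sqr_ge0.
split => //; rewrite -lee_fin /Rintegral fineK//.
by apply: integrable_fin_num.
Qed.

End lower_semicontinuity.

(** * Limits of test functions with gradients converging in L2 *)

Section L2_extra.
Context d (T : measurableType d) (R : realType) (mu : {measure set T -> \bar R}).
Implicit Types (f g e : T -> R).

Lemma L2_cvg_norm (f_ : (T -> R)^nat) f : (forall n, L2 mu (f_ n)) -> L2 mu f ->
  (fun n => \int[mu]_x ((f_ n x - f x) ^+ 2)) @ \oo --> 0 ->
  (fun n => \int[mu]_x (f_ n x ^+ 2)) @ \oo --> \int[mu]_x (f x ^+ 2).
Proof.
move=> Lfn Lf c.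
have c1 := L2_pairing_cvg Lfn Lf Lf c.
have -> : (fun n => \int[mu]_x (f_ n x ^+ 2)) = (fun n => \int[mu]_x ((f_ n x - f x) ^+ 2)
    + (2 * \int[mu]_x (f_ n x * f x) - \int[mu]_x (f x ^+ 2))).
  apply/funext => n; have Lnf := L2M (Lfn n) Lf; have [_ L0] := L2B (Lfn n) Lf;
      have [_ ff] := Lf.
  rewrite -Rint_scale// -Rint_sub//; last exact: integrableRZ.
  by rewrite -Rint_add//; [apply: eq_Rint => x; ring|apply: integrableRB => //; exact:
      integrableRZ].
rewrite -[X in _ --> X]add0r; apply: cvgD => //.
have E : \int[mu]_x (f x ^+ 2) = 2 * \int[mu]_x (f x * f x) - \int[mu]_x (f x ^+ 2).
  rewrite (@eq_Rint _ _ _ mu (fun x => f x * f x) (fun x => f x ^+ 2)); first by ring.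
  by move=> x; rewrite expr2.
rewrite [X in _ --> X]E.
by apply: cvgB; [exact: cvgMl_tmp|exact: cvg_cst].
Qed.

Lemma cvg0_double (u a : R^nat) (b : nat -> R^nat) : (forall n, 0 <= u n) ->
  (forall k n, u n <= a k + b k n) -> a @ \oo --> 0 -> (forall k, b k @ \oo --> 0) ->
  u @ \oo --> 0.
Proof.
move=> u0 uab a0 b0; apply/cvgr0Pnorm_lt => e e0.
have e2 : 0 < e / 2 by rewrite divr_gt0.
have /cvgr0Pnorm_lt/(_ _ e2)[k _ /(_ k (leqnn k)) /= hk] := a0.
have /cvgr0Pnorm_lt/(_ _ e2)[n _ hn] := b0 k.
exists n => // m /hn /= hm.
rewrite ger0_norm ?u0// (le_lt_trans (uab k m))// [ltRHS]splitr.
by rewrite ltrD// ?(le_lt_trans (ler_norm _) hk)// (le_lt_trans (ler_norm _) hm).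
Qed.

Lemma squeeze0 (u v : R^nat) : (forall n, 0 <= u n) -> (forall n, u n <= v n) ->
  v @ \oo --> 0 -> u @ \oo --> 0.
Proof.
move=> u0 uv v0; apply: (squeeze_cvgr _ (cvg_cst 0) v0).
by apply: nearW => n; rewrite u0 uv.
Qed.

End L2_extra.

Section approximable.
Context {R : realType} {N : nat}.
Local Notation V := 'rV[R]_N.
Local Notation mu := (lebesgue_rV R N).
Implicit Types (f g u v psi : V -> R) (i j : 'I_N).

Lemma measurable_shift_diff i h u : measurable_fun setT u ->
    measurable_fun setT (shift_diff i h u).
Proof.
by move=> mu'; apply: measurable_funB => //; exact: measurable_fun_shift.
Qed.

Lemma L1loc_shift_diff i h (f_ : (V -> R)^nat) f : (forall k, measurable_fun setT (f_ k)) ->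
  measurable_fun setT f -> L1loc_cvg f_ f ->
  L1loc_cvg (fun k => shift_diff i h (f_ k)) (shift_diff i h f).
Proof.
move=> mf_ mf c; apply: L1loc_sub => //.
- by move=> k; exact: measurable_fun_shift.
- exact: measurable_fun_shift.
- exact: L1loc_shift.
Qed.

(** What membership of [w] in the homogeneous Sobolev space provides: test
functions [phi k] approximating [w] and its weak gradient [G]. *)
Record approximable (w : V -> R) (G : 'I_N -> V -> R) (phi : nat -> V -> R) : Prop := {
  appr_meas : measurable_fun setT w;
  appr_grad : forall j, L2 mu (G j);
  appr_test : forall k, test_function (phi k);
  appr_cvg : forall j, (fun k => \int[mu]_x ((partial j (phi k) x - G j x) ^+ 2)) @ \oo --> 0;
  appr_loc : L1loc_cvg phi w }.

Variables (w : V -> R) (G : 'I_N -> V -> R) (phi : nat -> V -> R).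
Hypothesis A : approximable w G phi.
Let mw := appr_meas A.
Let LG := appr_grad A.
Let tphi := appr_test A.
Let cG := appr_cvg A.
Let cw := appr_loc A.
Let Lphi k : L2 mu (phi k). Proof. exact: L2_test. Qed.
Let Ldphi k j : L2 mu (partial j (phi k)). Proof. by apply: L2_test; exact: test_partial. Qed.

(** The increments of [phi k - phi l] are controlled by its gradient; lower
semicontinuity lets [l] tend to infinity. *)
Lemma shift_diff_approx i h k : L2 mu (fun x =>
    shift_diff i h (phi k) x - shift_diff i h w x) /\
  \int[mu]_x ((shift_diff i h (phi k) x - shift_diff i h w x) ^+ 2) <=
  h ^+ 2 * \int[mu]_x ((partial i (phi k) x - G i x) ^+ 2).
Proof.
pose f_ l x := shift_diff i h (phi k) x - shift_diff i h (phi l) x.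
apply: (@L2_lower_semicontinuity _ _ f_ _ (fun l =>
    h ^+ 2 * \int[mu]_x ((partial i (phi k) x - partial i (phi l) x) ^+ 2))).
- by move=> l; apply: L2B; exact: L2_shift_diff.
- by apply: measurable_funB; apply: measurable_shift_diff => //; case: (Lphi k).
- apply: L1loc_sub => //.
  + by move=> _; apply: measurable_shift_diff; case: (Lphi k).
  + by move=> l; apply: measurable_shift_diff; case: (Lphi l).
  + by apply: measurable_shift_diff; case: (Lphi k).
  + exact: measurable_shift_diff.
  + exact: L1loc_cst.
  + by apply: L1loc_shift_diff => // l; case: (Lphi l).
- move=> l; have tkl := test_sub (tphi k) (tphi l).
  have := norm_diff_test i h tkl.
  rewrite (eq_Rint mu (g := fun x => f_ l x ^+ 2)); last by move=> x;
      rewrite /f_ /shift_diff; congr (_ ^+ 2); ring.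
  move=> /le_trans; apply; rewrite le_eqVlt; apply/orP; left; apply/eqP; congr (_ * _).
  apply: eq_Rint => x; congr (_ ^+ 2).
  apply: deriveB; apply: smooth_derivable; exact: test_smooth.
- apply: cvgMl_tmp.
  apply: (@L2_cvg_norm _ _ _ _ (fun l x => partial i (phi k) x - partial i (phi l) x)).
  + by move=> l; exact: L2B.
  + exact: L2B.
  + rewrite (_ : (fun l => _) = (fun l => \int[mu]_x ((partial i (phi l) x - G i x) ^+ 2)))//.
    by apply/funext => l; apply: eq_Rint => x; ring.
Qed.

Lemma L2_shift_diff_limit i h : L2 mu (shift_diff i h w).
Proof.
have [L _] := shift_diff_approx i h 0.
have := L2B (L2_shift_diff i h (Lphi 0)) L.
by congr L2; apply/funext => x; ring.
Qed.

Lemma shift_diff_cvg i h :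
  (fun k => \int[mu]_x ((shift_diff i h (phi k) x - shift_diff i h w x) ^+ 2)) @ \oo --> 0.
Proof.
apply: (squeeze0 _ (fun k => (shift_diff_approx i h k).2)).
  by move=> k; apply: Rint_ge0 => x; exact: sqr_ge0.
by rewrite -(mulr0 (h ^+ 2)); apply: cvgMl_tmp.
Qed.

Lemma norm_diff_limit i h :
  \int[mu]_x (shift_diff i h w x ^+ 2) <= h ^+ 2 * \int[mu]_x (G i x ^+ 2).
Proof.
have c1 := L2_cvg_norm (fun k => L2_shift_diff i h (Lphi k)) (L2_shift_diff_limit i h)
    (@shift_diff_cvg i h).
have c2 : (fun k => h ^+ 2 * \int[mu]_x (partial i (phi k) x ^+ 2)) @ \oo -->
    h ^+ 2 * \int[mu]_x (G i x ^+ 2).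
  by apply: cvgMl_tmp; apply: L2_cvg_norm => //.
apply: ler_cvg_to c1 c2 _; apply: nearW => k; exact: norm_diff_test.
Qed.

Lemma L2_diff_quot i h u : L2 mu (shift_diff i h u) -> L2 mu (diff_quot i h u).
Proof. exact: L2Z. Qed.

(** The quotients of [w - phi k] are bounded by the gradient error uniformly in
[h], while the quotient of each fixed [phi k] converges. *)
Lemma diff_quot_limit_cvg i (h : R^nat) H : (forall n, h n != 0) -> (forall n, `|h n| <= H) ->
  h @ \oo --> 0 ->
  (fun n => \int[mu]_x ((diff_quot i (h n) w x - G i x) ^+ 2)) @ \oo --> 0.
Proof.
move=> hn0 hH h0.
(* [6 = 3 + 3]: the gradient error bounds the first and the third of the three terms
into which the difference is split. *)
pose a k := 6 * \int[mu]_x ((partial i (phi k) x - G i x) ^+ 2).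
pose b k n := 3 * \int[mu]_x ((diff_quot i (h n) (phi k) x - partial i (phi k) x) ^+ 2).
apply: (@cvg0_double _ _ a b).
- by move=> n; apply: Rint_ge0 => x; exact: sqr_ge0.
- move=> k n; have Lqw := L2_diff_quot (L2_shift_diff_limit i (h n)).
  have Lqp := L2_diff_quot (L2_shift_diff i (h n) (Lphi k)).
  have L1 := L2B Lqp Lqw; have L2' := L2B Lqp (Ldphi k i); have L3 := L2B (Ldphi k i) (LG i).
  apply: (@le_trans _ _ (3 * \int[mu]_x ((diff_quot i (h n) (phi k) x - diff_quot i (h n) w x)
      ^+ 2) +
     (b k n + 3 * \int[mu]_x ((partial i (phi k) x - G i x) ^+ 2)))).
    rewrite /b -(Rint_scale 3 (proj2 L1)) -(Rint_scale 3 (proj2 L2')) -(Rint_scale 3 (proj2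
        L3)).
    have i1 := integrableRZ 3 (proj2 L1); have i2 := integrableRZ 3 (proj2 L2'); have i3 :=
        integrableRZ 3 (proj2 L3).
    rewrite -(Rint_add i2 i3) -(Rint_add i1 (integrableRD i2 i3)); apply: le_Rint.
    + by have [] := L2B Lqw (LG i).
    + exact: integrableRD i1 (integrableRD i2 i3).
    + move=> x; set p := diff_quot _ _ (phi k) x; set q := diff_quot _ _ w x; set r :=
        partial _ _ _; set s := G _ _.
      have := sqr_ge0 ((p - q) + (p - r)); have := sqr_ge0 ((p - r) - (r - s)); have :=
          sqr_ge0 ((p - q) + (r - s)).
      nra.
  set X := \int[mu]_x (_ ^+ 2).
  suff : X <= \int[mu]_x ((partial i (phi k) x - G i x) ^+ 2).
    by rewrite /a; move: (b k n) => c; lra.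
  rewrite /X.
  have [L4 le4] := shift_diff_approx i (h n) k.
  rewrite (eq_Rint mu (g := fun x => (h n)^-1 ^+ 2 * (shift_diff i (h n) (phi k) x -
      shift_diff i (h n) w x) ^+ 2)); last first.
    by move=> x; rewrite /diff_quot /shift_diff; ring.
  rewrite Rint_scale; last by case: L4.
  have hp : 0 < h n ^+ 2 by rewrite lt_neqAle sqr_ge0 eq_sym sqrf_eq0 hn0.
  by rewrite exprVn ler_pdivrMl.
- by rewrite -(mulr0 6); apply: cvgMl_tmp.
- move=> k; rewrite -(mulr0 3); apply: cvgMl_tmp.
  by apply: diff_quot_cvg_L2 => //; exact: hH.
Qed.

End approximable.

(** * Testing the equation with increments *)

Section weak_equation.
Context {R : realType} {N : nat}.
Local Notation V := 'rV[R]_N.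
Local Notation mu := (lebesgue_rV R N).
Implicit Types (u v psi e : V -> R) (i j : 'I_N).

Lemma cvgDn (u v : R^nat) a b : u @ \oo --> a -> v @ \oo --> b ->
  (fun n => u n + v n) @ \oo --> a + b.
Proof. by move=> ua vb; exact: cvgD. Qed.

Lemma cvgBn (u v : R^nat) a b : u @ \oo --> a -> v @ \oo --> b ->
  (fun n => u n - v n) @ \oo --> a - b.
Proof. by move=> ua vb; exact: cvgB. Qed.

Lemma cvg_sumR (s : seq 'I_N) (F : 'I_N -> R^nat) (l : 'I_N -> R) :
  (forall j, F j @ \oo --> l j) ->
  (fun n => \sum_(j <- s) F j n) @ \oo --> \sum_(j <- s) l j.
Proof.
move=> c; elim: s => [|j s IH].
  by rewrite big_nil; under eq_fun do rewrite big_nil; exact: cvg_cst.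
rewrite big_cons; under eq_fun do rewrite big_cons.
by apply: cvgD => //; exact: c.
Qed.

Lemma test_shift_diff i h psi : test_function psi -> test_function (shift_diff i h psi).
Proof. by move=> tp; apply: test_sub => //; exact: test_shift. Qed.

Lemma partial_shift_diff i j h psi x : test_function psi ->
  partial j (shift_diff i h psi) x = shift_diff i h (partial j psi) x.
Proof.
move=> tp; have sp := test_smooth tp.
have dp y k : derivable psi y (unit_vec k) by exact: smooth_derivable.
have ds y k : derivable (fun x => psi (x + h *: unit_vec i)) y (unit_vec k).
  by apply: smooth_derivable; apply: test_smooth; exact: test_shift.
have E : partial j (shift_diff i h psi) x =
   partial j (fun x => psi (x + h *: unit_vec i)) x - partial j psi x by exact:
       (deriveB (ds x j) (dp x j)).
rewrite E /shift_diff; congr (_ - _).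
have := @partial_affine _ _ psi 1 (h *: unit_vec i) j x (dp _ j).
rewrite mul1r scale1r => <-; congr (partial j _ x).
by apply/funext => y; rewrite scale1r.
Qed.

Variables (w : V -> R) (G : 'I_N -> V -> R) (phi : nat -> V -> R) (f : V -> R).
Hypothesis A : approximable w G phi.
Hypothesis Lf : forall theta, test_function theta -> L2 mu (fun x => f x * theta x).
Hypothesis weq : forall theta, test_function theta ->
  \sum_j \int[mu]_x (G j x * partial j theta x) = \int[mu]_x (f x * theta x).
Let LG := appr_grad A.
Let tphi := appr_test A.
Let cG := appr_cvg A.

Lemma L2_testM psi e : test_function psi -> L2 mu e -> L2 mu (fun x => psi x * e x).
Proof.
move=> tp Le; have [K _ pK] := test_bounded tp.
by apply: (@L2_Mbounded _ _ _ _ K) => //; exact: test_measurable.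
Qed.

Lemma integrableR_testM psi e : test_function psi -> integrableR mu e ->
    integrableR mu (fun x => psi x * e x).
Proof.
move=> tp Le; have [K _ pK] := test_bounded tp.
by apply: (@integrableR_Mbounded _ _ _ _ K) => //; exact: test_measurable.
Qed.

(** The weak equation tested with [psi (w (x + h e_i) - w x)], as the limit of
[psi (phi k (x + h e_i) - phi k x)]. *)
Lemma weak_diff psi i h : test_function psi ->
  \sum_j (\int[mu]_x (shift_diff i h w x * (partial j psi x * G j x))
        + \int[mu]_x (shift_diff i h (G j) x * (psi x * G j x))) =
  \int[mu]_x (shift_diff i h w x * (f x * psi x)).
Proof.
move=> tp.
have tD k := test_shift_diff i h (tphi k).
have LD k := L2_test (tD k).
have LDw := L2_shift_diff_limit A i h.
have LDG j : L2 mu (shift_diff i h (G j)) := L2_shift_diff i h (LG j).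
have LDd k j : L2 mu (shift_diff i h (partial j (phi k))).
  by apply: L2_shift_diff; apply: L2_test; exact: test_partial.
have Lg1 j : L2 mu (fun x => partial j psi x * G j x).
  by apply: L2_testM => //; exact: test_partial.
have Lg2 j : L2 mu (fun x => psi x * G j x) by exact: L2_testM.
have E k : \sum_j (\int[mu]_x (shift_diff i h (phi k) x * (partial j psi x * G j x))
        + \int[mu]_x (shift_diff i h (partial j (phi k)) x * (psi x * G j x))) =
  \int[mu]_x (shift_diff i h (phi k) x * (f x * psi x)).
  have tt : test_function (fun x => shift_diff i h (phi k) x * psi x).
    by apply: test_mul => //; exact: test_smooth.
  transitivity (\int[mu]_x (f x * (shift_diff i h (phi k) x * psi x))); last first.
    by apply: eq_Rint => x; ring.
  rewrite -weq//; apply: eq_bigr => j _.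
  rewrite -Rint_add; [|exact: L2M|exact: L2M].
  apply: eq_Rint => x; rewrite partialM.
  - by rewrite partial_shift_diff//; ring.
  - by apply: smooth_derivable; exact: test_smooth.
  - by apply: smooth_derivable; exact: test_smooth.
have cD := @shift_diff_cvg _ _ _ _ _ A i h.
have cDG j : (fun k => \int[mu]_x ((shift_diff i h (partial j (phi k)) x - shift_diff i h (G
    j) x) ^+ 2)) @ \oo --> 0.
  apply: (@squeeze0 _ _ (fun k => 4 * \int[mu]_x ((partial j (phi k) x - G j x) ^+ 2))).
  - by move=> k; apply: Rint_ge0 => x; exact: sqr_ge0.
  - move=> k; have Ld : L2 mu (fun x => partial j (phi k) x - G j x).
      by apply: L2B => //; apply: L2_test; exact: test_partial.
    have Ls := L2_shift (h *: unit_vec i) Ld.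
    have Ln := L2Z (-1) Ld.
    apply: (le_trans _ (le_trans (sqr_norm_add_le Ls Ln) _)).
      rewrite le_eqVlt; apply/orP; left; apply/eqP; apply: eq_Rint => x.
      by rewrite /shift_diff; ring.
    rewrite (Rint_shift (h *: unit_vec i) (f := fun x =>
        (partial j (phi k) x - G j x) ^+ 2)); last by case: Ld.
    rewrite (eq_Rint mu (f := fun x => (-1 * _) ^+ 2) (g := fun x =>
        (partial j (phi k) x - G j x) ^+ 2)); last by move=> x; ring.
    lra.
  - by rewrite -(mulr0 4); apply: cvgMl_tmp.
have c1 : (fun k => \sum_j (\int[mu]_x (shift_diff i h (phi k) x * (partial j psi x * G j x))
        + \int[mu]_x (shift_diff i h (partial j (phi k)) x * (psi x * G j x)))) @ \oo -->
   \sum_j (\int[mu]_x (shift_diff i h w x * (partial j psi x * G j x))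
        + \int[mu]_x (shift_diff i h (G j) x * (psi x * G j x))).
  by apply: cvg_sumR => j; apply: cvgD; exact: L2_pairing_cvg.
have c2 := L2_pairing_cvg LD LDw (Lf tp) cD.
rewrite -(funext E) in c2.
exact: cvg_unique c1 c2.
Qed.

(** A fixed window sees less and less of the mass of [u] as [u] is translated to
infinity. *)
Lemma pairing_far_translate_cvg0 M g u i : (forall x, M < `|x| -> g x = 0) -> L2 mu g ->
    L2 mu u ->
  (fun n => \int[mu]_x (u (x + n%:R *: unit_vec i) * g x)) @ \oo --> 0.
Proof.
move=> pM Lpg Lu.
pose B := [set x : V | `|x| <= M].
have mB : measurable_fun setT (\1_B : V -> R).
  by apply: measurable_indic; exact: measurable_norm_le.
have B1 x : `|\1_B x : R| <= 1.
  by rewrite indicE ger0_norm//; case: (x \in B) => /=; rewrite ?lexx ?ler01.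
have Lun n : L2 mu (fun x => \1_B x * u (x + n%:R *: unit_vec i)).
  by apply: (@L2_Mbounded _ _ _ _ 1) => //; exact: L2_shift.
apply: (@cvg0_sqr _ _ (fun n => \int[mu]_x ((\1_B x * u (x + n%:R *: unit_vec i)) ^+ 2) *
    \int[mu]_x (g x ^+ 2))).
  move=> n; apply: le_trans (cauchy_schwarz (Lun n) Lpg).
  rewrite (eq_Rint mu (g := fun x => \1_B x * u (x + n%:R *: unit_vec i) * g x))// => x.
  rewrite indicE; have [xM|Mx] := leP `|x| M; first by rewrite mem_set//= mul1r.
  by rewrite pM// !mulr0.
rewrite -(mul0r (\int[mu]_x (g x ^+ 2))); apply: cvgMr_tmp.
have -> : (fun n => \int[mu]_x ((\1_B x * u (x + n%:R *: unit_vec i)) ^+ 2)) =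
    (fun n => \int[mu]_x (\1_B (x - n%:R *: unit_vec i) * u x ^+ 2)).
  apply/funext => n.
  have iu : integrableR mu (fun x => \1_B (x - n%:R *: unit_vec i) * u x ^+ 2).
    apply: (@integrableR_Mbounded _ _ _ _ 1) => //; last by case: Lu.
    exact: measurable_fun_shift.
  rewrite -(Rint_shift (n%:R *: unit_vec i) iu); apply: eq_Rint => x.
  rewrite addrK exprMn !indicE; congr (_ * _).
  by case: (x \in B); rewrite ?expr1n ?expr0n.
have -> : 0 = \int[mu]_x (0 * u x ^+ 2).
  by rewrite (eq_Rint mu (g := fun=> 0)) ?Rint0// => x; rewrite mul0r.
apply: (@cvg_bounded_multiplier _ _ _ _ 1); last by case: Lu.
- by move=> n; exact: measurable_fun_shift.
- by move=> n x; exact: B1.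
- move=> x; apply: cvg_near_cst.
  have [k _ hk] : \forall n \near \oo, M + `|x| < n%:R.
    by near=> n; apply: (@lt_le_trans _ _ (M + `|x| + 1)); rewrite ?ltrDl//; near: n;
        exact: nbhs_infty_ger.
  exists k => // n /hk /= hn; rewrite indicE memNset// /B /=.
  apply/negP; rewrite -ltNge -(ltrD2r `|x|) (lt_le_trans hn)//.
  have e1 : 1 <= `|unit_vec i : V|.
    by have := coord_le_norm (unit_vec i : V) i; rewrite /unit_vec mxE !eqxx normr1.
  have := ler_normB x (x - n%:R *: unit_vec i);
      rewrite opprB addrC subrK normrZ normr_nat => h.
  rewrite addrC; apply: le_trans h; by rewrite ler_peMr.
Unshelve. all: by end_near. Qed.

(** The weak equation tested with [psi w].  As [phi k] is not known to approach
[w] in L2, this is obtained from increments of length [n]: the translate by [n e_i]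
is negligible on the support of [psi] when [n] tends to infinity. *)
Lemma local_energy psi i : L2 mu w -> test_function psi ->
  \sum_j (\int[mu]_x (w x * (partial j psi x * G j x))
        + \int[mu]_x (psi x * G j x ^+ 2)) =
  \int[mu]_x (w x * (f x * psi x)).
Proof.
move=> Lw tp.
have Lg1 j : L2 mu (fun x => partial j psi x * G j x).
  by apply: L2_testM => //; exact: test_partial.
have Lg2 j : L2 mu (fun x => psi x * G j x) by exact: L2_testM.
have split u g : L2 mu u -> L2 mu g -> forall n,
   \int[mu]_x (shift_diff i n u x * g x) =
   \int[mu]_x (u (x + n *: unit_vec i) * g x) - \int[mu]_x (u x * g x).
  move=> Lu Lg n; rewrite -Rint_sub; [|by apply: L2M => //; exact: L2_shift|exact: L2M].
  by apply: eq_Rint => x; rewrite /shift_diff; ring.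
have [M M0 pM] := test_support tp.
have cs u g : L2 mu u -> L2 mu g -> (forall x, M < `|x| -> g x = 0) ->
   (fun n : nat => \int[mu]_x (shift_diff i n%:R u x * g x)) @ \oo -->
     - \int[mu]_x (u x * g x).
  move=> Lu Lg gM; rewrite (funext (fun n : nat => split u g Lu Lg n%:R)).
  have c0 := @pairing_far_translate_cvg0 M g u i gM Lg Lu.
  have cc : (fun _ : nat => \int[mu]_x (u x * g x)) @ \oo -->
      \int[mu]_x (u x * g x) by exact: cvg_cst.
  by have := cvgBn c0 cc; rewrite sub0r.
have dpM j x : M < `|x| -> partial j psi x = 0 by exact: partial_support.
have c1 : (fun n : nat => \sum_j (\int[mu]_x (shift_diff i n%:R w x * (partial j psi x * G j
    x))
        + \int[mu]_x (shift_diff i n%:R (G j) x * (psi x * G j x)))) @ \oo -->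
   \sum_j ((- (\int[mu]_x (w x * (partial j psi x * G j x))))
        + (- (\int[mu]_x (G j x * (psi x * G j x))))).
  apply: cvg_sumR => j.
  have k1 := cs w _ Lw (Lg1 j); have k2 := cs (G j) _ (LG j) (Lg2 j).
  apply: cvgDn; [apply: k1|apply: k2] => x Mx; first by rewrite dpM// mul0r.
  by rewrite pM// mul0r.
have c2 : (fun n : nat => \int[mu]_x (shift_diff i n%:R w x * (f x * psi x))) @ \oo -->
    - \int[mu]_x (w x * (f x * psi x)).
  by apply: cs => //; [exact: Lf|move=> x Mx; rewrite pM// mulr0].
rewrite (funext (fun n : nat => weak_diff i n%:R tp)) in c1.
have := cvg_unique _ c1 c2 => /(_ (@Rhausdorff R)) E.
apply: oppr_inj; rewrite -E -sumrN; apply: eq_bigr => j _.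
rewrite opprD; congr (_ - _); apply: eq_Rint => x; ring.
Qed.

End weak_equation.

(** * Chain rules by convexity *)

Section chain_rule.
Context {R : realType} {N : nat}.
Local Notation V := 'rV[R]_N.
Local Notation mu := (lebesgue_rV R N).
Implicit Types (u v psi e : V -> R) (i j : 'I_N).

Lemma shift_by_parts K psi e (h : V) : measurable_fun setT psi ->
  (forall x, `|psi x| <= K) -> integrableR mu e ->
  \int[mu]_x (psi x * (e (x + h) - e x)) = \int[mu]_x ((psi (x - h) - psi x) * e x).
Proof.
move=> mp pK ie.
have mph := measurable_fun_shift (- h) mp.
have i1 : integrableR mu (fun x => psi (x - h) * e x) by exact:
    (integrableR_Mbounded mph _ ie).
have i2 : integrableR mu (fun x => psi x * e x) by exact: (integrableR_Mbounded mp pK ie).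
have i3 : integrableR mu (fun x => psi x * e (x + h)).
  exact: (integrableR_Mbounded mp pK (integrableR_shift h ie)).
transitivity (\int[mu]_x (psi x * e (x + h)) - \int[mu]_x (psi x * e x)).
  by rewrite -Rint_sub//; apply: eq_Rint => x; ring.
transitivity (\int[mu]_x (psi (x - h) * e x) - \int[mu]_x (psi x * e x)); last first.
  by rewrite -Rint_sub//; apply: eq_Rint => x; ring.
by rewrite -(Rint_shift h i1); congr (_ - _); apply: eq_Rint => x; rewrite addrK.
Qed.

(** A translation moves the difference quotient from [e], which is only
integrable, to the Lipschitz function [psi]. *)
Lemma diff_quot_by_parts K L psi e i (h : R^nat) : measurable_fun setT psi ->
  (forall x, `|psi x| <= K) -> (forall x, derivable psi x (unit_vec i)) ->
  (forall x, `|partial i psi x| <= L) -> integrableR mu e ->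
  (forall n, h n != 0) -> h @ \oo --> 0 ->
  (fun n => (h n)^-1 * \int[mu]_x (psi x * (e (x + h n *: unit_vec i) - e x))) @ \oo -->
  - (\int[mu]_x (partial i psi x * e x)).
Proof.
move=> mp pK dp dpL ie hn0 h0.
have hN0 n : - h n != 0 by rewrite oppr_eq0.
have hN : (fun n => - h n) @ \oo --> 0 by rewrite -oppr0; exact: cvgN.
pose F n x := diff_quot i (- h n) psi x.
have mF n : measurable_fun setT (F n).
  by apply: measurable_funM => //; apply: measurable_funB => //; exact: measurable_fun_shift.
have FL n x : `|F n x| <= L.
  rewrite /F /diff_quot /shift_diff normrM normfV ler_pdivrMl ?normr_gt0// mulrC.
  exact: derivable_lipschitz.
have cF x : F ^~ x @ \oo --> partial i psi x by exact: derivable_cvg_quot.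
have c := cvg_bounded_multiplier mF FL cF ie.
have E n : (h n)^-1 * \int[mu]_x (psi x * (e (x + h n *: unit_vec i) - e x)) =
    - \int[mu]_x (F n x * e x).
  rewrite (shift_by_parts _ mp pK ie) -mulN1r -!Rint_scale; last 2 first.
  - exact: (integrableR_Mbounded (mF n) (FL n) ie).
  - have := integrableRZ (- h n) (integrableR_Mbounded (mF n) (FL n) ie).
    congr integrableR; apply/funext => x;
        rewrite /F /diff_quot /shift_diff !mulrA mulfV// mul1r scaleNr.
    by [].
  by apply: eq_Rint => x; rewrite /F /diff_quot /shift_diff scaleNr invrN; ring.
rewrite (funext E); exact: cvgN.
Qed.

(** The quantity [J h] is only bounded from above, but dividing by a positive
and by a negative [h] turns this into the two inequalities between the limits. *)
Lemma chain_rule psi e i (J : R -> R) (L : R) : test_function psi -> integrableR mu e ->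
  (forall h, J h <= \int[mu]_x (psi x * (e (x + h *: unit_vec i) - e x))) ->
  (forall h : R^nat, (forall n, h n != 0) -> (forall n, `|h n| <= 1) -> h @ \oo --> 0 ->
    (fun n => (h n)^-1 * J (h n)) @ \oo --> L) ->
  L = - (\int[mu]_x (partial i psi x * e x)).
Proof.
move=> tp ie HJ HL.
have mp := test_measurable tp; have [K _ pK] := test_bounded tp.
have [L' _ dpL] := test_bounded (test_partial i tp).
have dp x : derivable psi x (unit_vec i) by apply: smooth_derivable; exact: test_smooth.
pose h n : R := n.+1%:R^-1.
have h_gt0 n : 0 < h n by rewrite invr_gt0.
have hn0 n : h n != 0 by rewrite gt_eqF.
have h1 n : `|h n| <= 1 by rewrite (ger0_norm (ltW (h_gt0 n))) /h invf_le1 ?ltr0n// ler1n.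
have h0 : h @ \oo --> 0 by exact: cvg_harmonic.
have hNn0 n : - h n != 0 by rewrite oppr_eq0.
have hN1 n : `|- h n| <= 1 by rewrite normrN.
have hN0 : (fun n => - h n) @ \oo --> 0 by rewrite -oppr0; exact: cvgN.
apply/eqP; rewrite eq_le; apply/andP; split.
  have c1 := HL h hn0 h1 h0; have c2 := diff_quot_by_parts mp pK dp dpL ie hn0 h0.
  apply: ler_cvg_to c1 c2 _; apply: nearW => n.
  by rewrite ler_wpM2l ?HJ// invr_ge0 ltW.
have c1 := HL _ hNn0 hN1 hN0; have c2 := diff_quot_by_parts mp pK dp dpL ie hNn0 hN0.
apply: ler_cvg_to c2 c1 _; apply: nearW => n.
by rewrite invrN !mulNr lerN2 ler_wpM2l ?HJ// invr_ge0 ltW.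
Qed.

Variables (w : V -> R) (G : 'I_N -> V -> R) (phi : nat -> V -> R).
Hypothesis A : approximable w G phi.
Hypothesis Lw : L2 mu w.
Let LG := appr_grad A.

Lemma pairing_diff_quot_cvg g i (h : R^nat) H : L2 mu g -> (forall n, h n != 0) ->
  (forall n, `|h n| <= H) -> h @ \oo --> 0 ->
  (fun n => \int[mu]_x (diff_quot i (h n) w x * g x)) @ \oo --> \int[mu]_x (G i x * g x).
Proof.
move=> Lg hn0 hH h0.
have Lq n : L2 mu (diff_quot i (h n) w) by apply: L2_diff_quot; exact:
    L2_shift_diff_limit A _ _.
have c := @diff_quot_limit_cvg _ _ _ _ _ A i h H hn0 hH h0.
exact: L2_pairing_cvg Lq (LG i) Lg c.
Qed.

Lemma Rint_diff_quot g i h : L2 mu g ->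
  h^-1 * \int[mu]_x (shift_diff i h w x * g x) = \int[mu]_x (diff_quot i h w x * g x).
Proof.
move=> Lg; rewrite -Rint_scale; last by apply: L2M => //; exact: L2_shift_diff_limit A _ _.
by apply: eq_Rint => x; rewrite /diff_quot /shift_diff mulrA.
Qed.

(** Formally, [p grad w = grad e] when [p] is a subgradient of [e] as a function
of [w]. *)
Lemma potential_identity p e psi i : (forall x, 0 <= psi x) -> test_function psi ->
  L2 mu (fun x => p x * psi x) -> integrableR mu e ->
  (forall x y, p x * (w y - w x) <= e y - e x) ->
  \int[mu]_x (psi x * (p x * G i x)) = - (\int[mu]_x (partial i psi x * e x)).
Proof.
move=> p0 tp Lp ie conv.
rewrite -(@chain_rule psi e i (fun h => \int[mu]_x (shift_diff i h w x * (p x * psi x)))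
  (\int[mu]_x (G i x * (p x * psi x)))) //.
- by apply: eq_Rint => x; ring.
- move=> h; have [K _ pK] := test_bounded tp; apply: le_Rint.
  + by apply: L2M => //; exact: L2_shift_diff_limit A _ _.
  + apply: (integrableR_Mbounded (test_measurable tp) pK); apply: integrableRB => //;
      exact: integrableR_shift.
  + move=> x; rewrite (_ : _ * _ = psi x * (p x * shift_diff i h w x)); last by ring.
    by apply: ler_wpM2l (p0 x) _ _ _; exact: conv.
- move=> h hn0 h1 h0; rewrite (funext (fun n => Rint_diff_quot i (h n) Lp)).
  exact: (@pairing_diff_quot_cvg _ i h 1 Lp hn0 h1 h0).
Qed.

(** Here [psi] has no sign and is only once differentiable, so convexity is not
available; but [w (w_h - w) = (w_h^2 - w^2) / 2 - (w_h - w)^2 / 2] and the integral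
of the last term is of order [h^2]. *)
Lemma weight_identity K L psi i : measurable_fun setT psi ->
  (forall x, `|psi x| <= K) -> (forall x, derivable psi x (unit_vec i)) ->
  (forall x, `|partial i psi x| <= L) ->
  \int[mu]_x (psi x * (w x * G i x)) = - (2^-1 * \int[mu]_x (partial i psi x * w x ^+ 2)).
Proof.
move=> mp pK dp dpL.
pose h n : R := n.+1%:R^-1.
have h_gt0 n : 0 < h n by rewrite invr_gt0.
have hn0 n : h n != 0 by rewrite gt_eqF.
have h1 n : `|h n| <= 1 by rewrite (ger0_norm (ltW (h_gt0 n))) /h invf_le1 ?ltr0n// ler1n.
have h0 : h @ \oo --> 0 by exact: cvg_harmonic.
have Lpw : L2 mu (fun x => psi x * w x) by exact: L2_Mbounded pK Lw.
have iw : integrableR mu (fun x => w x ^+ 2) by case: Lw.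
have c1 := @pairing_diff_quot_cvg _ i h 1 Lpw hn0 h1 h0.
have c2 := diff_quot_by_parts mp pK dp dpL iw hn0 h0.
have LD n : L2 mu (shift_diff i (h n) w) by exact: L2_shift_diff_limit A _ _.
have K0 : 0 <= K by exact: le_trans (pK 0).
have ip n : integrableR mu (fun x => psi x * (shift_diff i (h n) w x) ^+ 2).
  by apply: (integrableR_Mbounded mp pK); case: (LD n).
have c3 : (fun n => (h n)^-1 * \int[mu]_x (psi x * (shift_diff i (h n) w x) ^+ 2)) @ \oo --> 0.
  apply: norm_cvg0.
  apply: (@squeeze0 _ _ (fun n => h n * (K * \int[mu]_x (G i x ^+ 2)))).
  - by move=> n.
  - move=> n; have hi : 0 <= (h n)^-1 by rewrite invr_ge0 ltW.
    rewrite normrM (ger0_norm hi) ler_pdivrMl//.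
    apply: le_trans (le_normr_Rintegral measurableT (ip n)) _.
    apply: (@le_trans _ _ (K * \int[mu]_x (shift_diff i (h n) w x ^+ 2))).
      rewrite -Rint_scale; last by case: (LD n).
      apply: le_Rint.
      + exact: (@integrable_norm _ _ _ mu setT _ (ip n)).
      + by apply: integrableRZ; case: (LD n).
      + move=> x; rewrite normrM [X in _ * X <= _]ger0_norm ?sqr_ge0//.
        by apply: ler_wpM2r; [exact: sqr_ge0|exact: pK].
    rewrite mulrA -expr2 mulrCA; apply: ler_wpM2l K0 _ _ _; exact: norm_diff_limit A _ _.
  - by rewrite -(mul0r (K * \int[mu]_x (G i x ^+ 2))); apply: cvgMr_tmp.
have E n : \int[mu]_x (diff_quot i (h n) w x * (psi x * w x)) =
   2^-1 * ((h n)^-1 * \int[mu]_x (psi x * (w (x + h n *: unit_vec i) ^+ 2 - w x ^+ 2))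
     - (h n)^-1 * \int[mu]_x (psi x * (shift_diff i (h n) w x) ^+ 2)).
  have ie : integrableR mu (fun x => psi x * (w (x + h n *: unit_vec i) ^+ 2 - w x ^+ 2)).
    apply: (integrableR_Mbounded mp pK); apply: integrableRB => //.
    exact: (integrableR_shift (h n *: unit_vec i) iw).
  rewrite -mulrBr -Rint_sub// -Rint_diff_quot// mulrCA; congr (_ * _).
  rewrite -Rint_scale; last exact: integrableRB.
  by apply: eq_Rint => x; rewrite /shift_diff; field.
have c4 : (fun n => \int[mu]_x (diff_quot i (h n) w x * (psi x * w x))) @ \oo -->
   2^-1 * (- (\int[mu]_x (partial i psi x * w x ^+ 2)) - 0).
  by rewrite (funext E); apply: cvgMl_tmp; exact: cvgBn c2 c3.
rewrite (eq_Rint mu (g := fun x => G i x * (psi x * w x))); last by move=> x; ring.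
have -> := cvg_unique (@Rhausdorff R) c1 c4; by rewrite subr0 mulrN.
Qed.

Variables (f : V -> R).
Hypothesis Lf : forall theta, test_function theta -> L2 mu (fun x => f x * theta x).
Hypothesis weq : forall theta, test_function theta ->
  \sum_j \int[mu]_x (G j x * partial j theta x) = \int[mu]_x (f x * theta x).

Definition energy x : R := \sum_j G j x ^+ 2.

Lemma integrableR_energy : integrableR mu energy.
Proof. by apply: integrableR_sum => j; case: (LG j). Qed.

(** This is the divergence of the stress-energy tensor
[d_i w d_j w - delta_ij |grad w|^2 / 2].  It follows from the convexity of the square:
[psi G_j (G_j (x + h e_i) - G_j x)] is at most [psi] times half the increment of
[G_j^2]. *)
Lemma stress_identity psi i : (forall x, 0 <= psi x) -> test_function psi ->
  \int[mu]_x (psi x * (f x * G i x)) =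
  \sum_j \int[mu]_x (partial j psi x * (G i x * G j x))
   - 2^-1 * \int[mu]_x (partial i psi x * energy x).
Proof.
move=> p0 tp; have [K _ pK] := test_bounded tp; have mp := test_measurable tp.
have ie : integrableR mu (fun x => 2^-1 * energy x) by apply: integrableRZ; exact:
    integrableR_energy.
have Lg1 j : L2 mu (fun x => partial j psi x * G j x).
  by apply: L2_testM => //; exact: test_partial.
have Lg2 j : L2 mu (fun x => psi x * G j x) by exact: L2_testM.
have LDG j h : L2 mu (shift_diff i h (G j)) := L2_shift_diff i h (LG j).
(* By [weak_diff], [J h / h] has a limit although the increments of [G] have none. *)
pose J h := \sum_j \int[mu]_x (shift_diff i h (G j) x * (psi x * G j x)).
pose S := \sum_j \int[mu]_x (G i x * (partial j psi x * G j x)).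
have Lfp := Lf tp.
have key : \int[mu]_x (G i x * (f x * psi x)) - S =
    - (\int[mu]_x (partial i psi x * (2^-1 * energy x))).
  apply: (chain_rule (J := J)) => // [h|h hn0 h1 h0].
    have iD j : integrableR mu (fun x => shift_diff i h (G j) x * (psi x * G j x)) by exact:
        L2M.
    rewrite /J -Rint_sum//; apply: le_Rint.
    - exact: integrableR_sum.
    - apply: (integrableR_Mbounded mp pK); apply: integrableRB => //; exact:
        (integrableR_shift (h *: unit_vec i) ie).
    - move=> x; rewrite /energy -mulrBr -sumrB !mulr_sumr; apply: ler_sum => j _.
      rewrite /shift_diff; set p := G j (x + _); set q := G j x.
      rewrite -subr_ge0 (_ : _ - _ = psi x * (2^-1 * (p - q) ^+ 2)); last by field.
      by apply: mulr_ge0 => //; apply: mulr_ge0 => //; exact: sqr_ge0.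
  have E n : (h n)^-1 * J (h n) = \int[mu]_x (diff_quot i (h n) w x * (f x * psi x)) -
      \sum_j \int[mu]_x (diff_quot i (h n) w x * (partial j psi x * G j x)).
    rewrite -(Rint_diff_quot i (h n) Lfp) -(weak_diff A Lf weq i (h n) tp).
    rewrite big_split mulrDr /= (_ : \sum_j \int[mu]_x (diff_quot i (h n) w x * (partial j psi
        x * G j x)) =
      (h n)^-1 * \sum_j \int[mu]_x (shift_diff i (h n) w x * (partial j psi x * G j x))).
      by rewrite /J; ring.
    by rewrite mulr_sumr; apply: eq_bigr => j _; rewrite Rint_diff_quot.
  rewrite (funext E); apply: cvgBn.
    exact: (@pairing_diff_quot_cvg _ i h 1 Lfp hn0 h1 h0).
  by apply: cvg_sumR => j; exact: (@pairing_diff_quot_cvg _ i h 1 (Lg1 j) hn0 h1 h0).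
have -> : \int[mu]_x (psi x * (f x * G i x)) = \int[mu]_x (G i x * (f x * psi x)).
  by apply: eq_Rint => x; ring.
have -> : \sum_j \int[mu]_x (partial j psi x * (G i x * G j x)) = S.
  by apply: eq_bigr => j _; apply: eq_Rint => x; ring.
have <- : \int[mu]_x (partial i psi x * (2^-1 * energy x)) =
    2^-1 * \int[mu]_x (partial i psi x * energy x).
  rewrite -Rint_scale; last by apply: integrableR_testM; [exact: test_partial|exact:
      integrableR_energy].
  by apply: eq_Rint => x; ring.
by rewrite -key; ring.
Qed.

End chain_rule.

(** * Dilated cutoffs, the energy identity and the virial identity *)

Section cutoff.
Context {R : realType} {N : nat}.
Local Notation V := 'rV[R]_N.
Local Notation mu := (lebesgue_rV R N).
Implicit Types (u v psi e g : V -> R) (i j : 'I_N).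

Definition dilation (n : nat) g : V -> R := fun x => g (n.+1%:R^-1 *: x).

Let c0 n : n.+1%:R^-1 != 0 :> R. Proof. by rewrite invr_neq0. Qed.

Lemma test_dilation n g : test_function g -> test_function (dilation n g).
Proof.
move=> /(test_affine 0 (c0 n)).
by under [X in test_function X]eq_fun do rewrite addr0.
Qed.

Lemma partial_dilation n g j x : smooth g ->
  partial j (dilation n g) x = n.+1%:R^-1 * partial j g (n.+1%:R^-1 *: x).
Proof.
move=> sg; have := @partial_affine _ _ g n.+1%:R^-1 0 j x _.
rewrite addr0 => <-; last by exact: smooth_derivable.
by congr (partial j _ x); apply/funext => y; rewrite addr0.
Qed.

Lemma dilation_cvg g e : test_function g -> integrableR mu e ->
  (fun n => \int[mu]_x (dilation n g x * e x)) @ \oo --> g 0 * \int[mu]_x e x.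
Proof.
move=> tg ie; rewrite -Rint_scale//; have [K _ gK] := test_bounded tg.
apply: (@cvg_bounded_multiplier _ _ _ _ K) => //.
- by move=> n; apply: test_measurable; exact: test_dilation.
- by move=> n x; exact: gK.
move=> x; have cx : (fun n : nat => (n.+1%:R^-1 : R) *: x) @ \oo --> (0 : V).
  by rewrite -(scale0r x); apply: cvgZr_tmp; exact: cvg_harmonic.
have cg := @smooth_continuous _ _ g (test_smooth tg) 0.
exact: cvg_comp cx cg.
Qed.

Lemma test_coordM i g : test_function g -> test_function (fun x : V => x ord0 i * g x).
Proof.
move=> tg; have := test_mul (smooth_coord 1 0 i) tg.
by under [X in test_function X]eq_fun do rewrite mul1r addr0.
Qed.

Lemma partial_coordM i j g x : test_function g ->
  partial j (fun x : V => x ord0 i * g x) x = x ord0 i * partial j g x + (i == j)%:R * g x.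
Proof.
move=> tg; have dc := is_derive_coord x (unit_vec j) i.
rewrite partialM; last 2 first.
- exact: ex_derive.
- by apply: smooth_derivable; exact: test_smooth.
rewrite /partial derive_val [g x * _]mulrC; congr (_ + _ * _).
by rewrite /unit_vec mxE eqxx /=.
Qed.

Variable eta : V -> R.
Hypothesis teta : test_function eta.
Hypothesis eta_ge0 : forall x, 0 <= eta x.
Hypothesis eta0 : eta 0 = 1.

(** The function [x_i eta] changes sign, but it is the difference of
[(x_i/2 + 1/2)^2 eta] and [(x_i/2 - 1/2)^2 eta]. *)
Lemma polarization (F : (V -> R) -> R) i :
  (forall psi, (forall x, 0 <= psi x) -> test_function psi -> F psi = 0) ->
  (forall u v, test_function u -> test_function v ->
     F (fun x => u x - v x) = F u - F v) ->
  forall n, F (fun x : V => x ord0 i * dilation n eta x) = 0.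
Proof.
move=> F0 FB n.
pose q (s : R) (x : V) := (2^-1 * x ord0 i + s) * ((2^-1 * x ord0 i + s) * dilation n eta x).
have tq s : test_function (q s).
  do 2 (apply: test_mul; first exact: smooth_coord); exact: test_dilation.
have q0 s x : 0 <= q s x by rewrite /q mulrA mulr_ge0 ?eta_ge0// -expr2 sqr_ge0.
have -> : (fun x : V => x ord0 i * dilation n eta x) = (fun x => q 2^-1 x - q (- 2^-1) x).
  by apply/funext => x; rewrite /q; field.
by rewrite FB// !F0// subrr.
Qed.

Lemma coord_dilation_scale i n : (fun x : V => x ord0 i * dilation n eta x) =
  (fun x => n.+1%:R * dilation n (fun y : V => y ord0 i * eta y) x).
Proof.
apply/funext => x; rewrite /dilation mxE !mulrA mulfV ?mul1r//.
Qed.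

(** The test function [x_i eta(x/(n+1))] is [n+1] times a dilated function, so
that its derivatives are dilations of a fixed test function; hence they are bounded
uniformly in [n] although [x_i] is not. *)
Lemma partial_coord_dilation i j n x : partial j (fun x : V => x ord0 i * dilation n eta x) x =
  dilation n (partial j (fun y : V => y ord0 i * eta y)) x.
Proof.
rewrite coord_dilation_scale.
have td : test_function (dilation n (fun y : V => y ord0 i * eta y)).
  by apply: test_dilation; exact: test_coordM.
have -> : partial j (fun x => n.+1%:R * dilation n (fun y : V => y ord0 i * eta y) x) x =
  n.+1%:R * partial j (dilation n (fun y : V => y ord0 i * eta y)) x.
  apply: deriveMl; apply: smooth_derivable; exact: test_smooth.
rewrite partial_dilation ?mulrA ?mulfV ?mul1r//.
by apply: test_smooth; exact: test_coordM.
Qed.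

Lemma partial_coord_dilation_cvg i j e : integrableR mu e ->
  (fun n => \int[mu]_x (partial j (fun x : V =>
      x ord0 i * dilation n eta x) x * e x)) @ \oo -->
  (i == j)%:R * \int[mu]_x e x.
Proof.
move=> ie.
have tx := test_partial j (test_coordM i teta).
have c := dilation_cvg tx ie.
rewrite partial_coordM// eta0 mulr1 [(0 : V) _ _]mxE mul0r add0r in c.
have E n : \int[mu]_x (partial j (fun x : V => x ord0 i * dilation n eta x) x * e x) =
    \int[mu]_x (dilation n (partial j (fun y : V => y ord0 i * eta y)) x * e x).
  by apply: eq_Rint => x; rewrite partial_coord_dilation.
by rewrite (funext E).
Qed.

Variables (w : V -> R) (G : 'I_N -> V -> R) (phi : nat -> V -> R) (f p rho e : V -> R).
Hypothesis A : approximable w G phi.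
Hypothesis Lw : L2 mu w.
Hypothesis weq : forall theta, test_function theta ->
  \sum_j \int[mu]_x (G j x * partial j theta x) = \int[mu]_x (f x * theta x).
Hypothesis fE : forall x, f x = p x - rho x * w x.
Hypothesis Lp : forall theta, test_function theta -> L2 mu (fun x => p x * theta x).
Hypothesis mrho : measurable_fun setT rho.
Hypothesis rho_bounded : forall theta, test_function theta ->
  exists K, forall x, `|rho x * theta x| <= K.
Hypothesis irw : integrableR mu (fun x => rho x * w x ^+ 2).
Hypothesis ipw : integrableR mu (fun x => p x * w x).
Hypothesis ie : integrableR mu e.
Hypothesis conv : forall x y, p x * (w y - w x) <= e y - e x.
Let mw := appr_meas A.
Let LG := appr_grad A.

Let Lrw theta : test_function theta -> L2 mu (fun x => rho x * theta x * w x).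
Proof.
move=> tt; have [K hK] := rho_bounded tt; apply: (@L2_Mbounded _ _ _ _ K) => //.
by apply: measurable_funM => //; exact: test_measurable.
Qed.

Lemma L2_rhs theta : test_function theta -> L2 mu (fun x => f x * theta x).
Proof.
move=> tt; have := L2B (Lp tt) (Lrw tt).
by congr L2; apply/funext => x; rewrite fE; ring.
Qed.

(** The limit of [local_energy] along dilated cutoffs; the term with the gradient
of the cutoff carries a factor [1/(n+1)]. *)
Lemma energy_identity (i0 : 'I_N) :
  \int[mu]_x energy G x = \int[mu]_x (p x * w x) - \int[mu]_x (rho x * w x ^+ 2).
Proof.
have E n := local_energy A L2_rhs weq i0 Lw (test_dilation n teta).
have LwG j : integrableR mu (fun x => w x * G j x) by exact: L2M.
have c1 : (fun n => \sum_j (\int[mu]_x (w x * (partial j (dilation n eta) x * G j x))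
     + \int[mu]_x (dilation n eta x * G j x ^+ 2))) @ \oo -->
   \sum_j (0 + eta 0 * \int[mu]_x (G j x ^+ 2)).
  apply: cvg_sumR => j; apply: cvgDn; last by apply: dilation_cvg => //; case: (LG j).
  have c := dilation_cvg (test_partial j teta) (LwG j).
  have h : (fun n : nat => n.+1%:R^-1 : R) @ \oo --> 0 by exact: cvg_harmonic.
  have hc : (fun n : nat => n.+1%:R^-1 * \int[mu]_x (dilation n (partial j eta) x * (w x * G j
      x)))
      @ \oo --> 0.
    by rewrite -(mul0r (partial j eta 0 * \int[mu]_x (w x * G j x))); exact: cvgM h c.
  have E' n : \int[mu]_x (w x * (partial j (dilation n eta) x * G j x)) =
      n.+1%:R^-1 * \int[mu]_x (dilation n (partial j eta) x * (w x * G j x)).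
    rewrite -Rint_scale; last by apply: integrableR_testM => //; apply: test_dilation;
        exact: test_partial.
    apply: eq_Rint => x; rewrite partial_dilation; last exact: test_smooth.
    by rewrite /dilation; ring.
  by rewrite (funext E').
have c2 : (fun n => \int[mu]_x (w x * (f x * dilation n eta x))) @ \oo -->
   eta 0 * \int[mu]_x (p x * w x) - eta 0 * \int[mu]_x (rho x * w x ^+ 2).
  have E' n : \int[mu]_x (w x * (f x * dilation n eta x)) =
      \int[mu]_x (dilation n eta x * (p x * w x)) - \int[mu]_x (dilation n eta x * (rho x * w
          x ^+ 2)).
    have tn := test_dilation n teta.
    rewrite -Rint_sub; [|exact: integrableR_testM|exact: integrableR_testM].
    by apply: eq_Rint => x; rewrite fE; ring.
  by rewrite (funext E'); apply: cvgBn; exact: dilation_cvg.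
rewrite (funext E) in c1; have := cvg_unique (@Rhausdorff R) c1 c2.
rewrite eta0 !mul1r => <-; rewrite Rint_sum; last by move=> j; case: (LG j).
by apply: eq_bigr => j _; rewrite add0r mul1r.
Qed.

Variables (i : 'I_N) (kappa : V -> R) (C : R).
Hypothesis drho : forall x, is_derive x (unit_vec i) (fun x => rho x * x ord0 i) (kappa x).
Hypothesis kappa_le : forall x, `|kappa x| <= C * `|rho x|.
Hypothesis mkappa : measurable_fun setT kappa.

(** The equation is tested with [x_i (d_i w) eta(x/(n+1))]: the three chain rules,
one for each term, are combined before [n] tends to infinity. *)
Lemma virial_identity :
  \int[mu]_x (G i x ^+ 2) - 2^-1 * \int[mu]_x energy G x + \int[mu]_x e x =
  2^-1 * \int[mu]_x (kappa x * w x ^+ 2).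
Proof.
pose ph n (x : V) := x ord0 i * dilation n eta x.
have tph n : test_function (ph n) by apply: test_coordM; exact: test_dilation.
have iE := integrableR_energy A.
have iGG j : integrableR mu (fun x => G i x * G j x) by exact: L2M.
have LGi := LG i.
have ifG theta : test_function theta -> integrableR mu (fun x => theta x * (f x * G i x)).
  by move=> tt; have := L2M (L2_rhs tt) LGi; congr integrableR; apply/funext => x; ring.
have ipG theta : test_function theta -> integrableR mu (fun x => theta x * (p x * G i x)).
  by move=> tt; have := L2M (Lp tt) LGi; congr integrableR; apply/funext => x; ring.
have irG theta : test_function theta -> integrableR mu (fun x =>
    theta x * (rho x * w x * G i x)).
  by move=> tt; have := L2M (Lrw tt) LGi; congr integrableR; apply/funext => x; ring.
have linI u v a : integrableR mu (fun x => u x * a x) -> integrableR mu (fun x => v x * a x) ->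
    \int[mu]_x ((u x - v x) * a x) = \int[mu]_x (u x * a x) - \int[mu]_x (v x * a x).
  by move=> ? ?; rewrite -Rint_sub//; apply: eq_Rint => x; ring.
have linD u v j a : test_function u -> test_function v -> integrableR mu a ->
    \int[mu]_x (partial j (fun x => u x - v x) x * a x) =
    \int[mu]_x (partial j u x * a x) - \int[mu]_x (partial j v x * a x).
  move=> tu tv ia; rewrite -linI; last 2 first.
  - by apply: integrableR_testM => //; exact: test_partial.
  - by apply: integrableR_testM => //; exact: test_partial.
  apply: eq_Rint => x; congr (_ * _).
  by apply: deriveB; apply: smooth_derivable; exact: test_smooth.
have alg1 (k a b c d s t : R) : a - b - (c - d - k * (s - t)) = a - (c - k * s) - (b - (d - k
    * t)).
  by ring.
have alg2 (a b c d : R) : a - b + (c - d) = a + c - (b + d) by ring.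
have S n : \int[mu]_x (ph n x * (f x * G i x)) =
    \sum_j \int[mu]_x (partial j (ph n) x * (G i x * G j x))
   - 2^-1 * \int[mu]_x (partial i (ph n) x * energy G x).
  apply/eqP; rewrite -subr_eq0; apply/eqP.
  apply: (polarization (F := fun psi => \int[mu]_x (psi x * (f x * G i x)) -
     (\sum_j \int[mu]_x (partial j psi x * (G i x * G j x))
       - 2^-1 * \int[mu]_x (partial i psi x * energy G x)))).
    by move=> psi p0 tp; rewrite (stress_identity A L2_rhs weq)// subrr.
  move=> u v tu tv; rewrite (linI u v _ (ifG u tu) (ifG v tv)).
  have sE : \sum_j \int[mu]_x (partial j (fun x => u x - v x) x * (G i x * G j x)) =
      \sum_j \int[mu]_x (partial j u x * (G i x * G j x)) -
      \sum_j \int[mu]_x (partial j v x * (G i x * G j x)).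
    by rewrite -sumrB; apply: eq_bigr => j _; exact: (linD u v j _ tu tv (iGG j)).
  rewrite [X in _ - (X - _) = _]sE.
  rewrite [X in _ - (_ - 2^-1 * X) = _](linD u v i _ tu tv iE).
  exact: alg1.
have P n : \int[mu]_x (ph n x * (p x * G i x)) = - (\int[mu]_x (partial i (ph n) x * e x)).
  apply/eqP; rewrite -subr_eq0 opprK; apply/eqP.
  apply: (polarization (F := fun psi => \int[mu]_x (psi x * (p x * G i x)) +
    \int[mu]_x (partial i psi x * e x))).
    move=> psi p0 tp; rewrite (@potential_identity _ _ w G phi A p e psi i)// ?addNr//.
    exact: Lp.
  move=> u v tu tv; rewrite (linI u v _ (ipG u tu) (ipG v tv)).
  by rewrite [X in _ + X = _](linD u v i _ tu tv ie); exact: alg2.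
have dk x : derivable (fun x => rho x * x ord0 i) x (unit_vec i) by exact: ex_derive.
have de n x : derivable (dilation n eta) x (unit_vec i).
  by apply: smooth_derivable; apply: test_smooth; exact: test_dilation.
pose g := fun y : V => y ord0 i * partial i eta y.
have tg : test_function g by apply: test_coordM; exact: test_partial.
have dW n x : is_derive x (unit_vec i) (fun x => (rho x * x ord0 i) * dilation n eta x)
    (dilation n eta x * kappa x + dilation n g x * rho x).
  split; first exact: derivableM.
  have -> : 'D_(unit_vec i) (fun x => rho x * x ord0 i * dilation n eta x) x =
     partial i (fun x => rho x * x ord0 i * dilation n eta x) x by [].
  rewrite partialM// partial_dilation; last exact: test_smooth.
  have -> : partial i (fun x => rho x * x ord0 i) x = kappa x by exact: derive_val.
  by rewrite /dilation /g mxE; ring.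
have ikw : integrableR mu (fun x => kappa x * w x ^+ 2).
  have iC : integrableR mu (fun x => C * `|rho x * w x ^+ 2|).
    by apply: integrableRZ; exact: (@integrable_norm _ _ _ mu setT).
  apply: (le_integrableR _ iC); first by apply: measurable_funM => //; exact: measurable_funX.
  by move=> x; rewrite [X in X <= _]normrM [X in C * X]normrM mulrA; apply: ler_wpM2r.
have W n : \int[mu]_x (ph n x * (rho x * w x * G i x)) =
   - (2^-1 * (\int[mu]_x (dilation n eta x * (kappa x * w x ^+ 2)) +
              \int[mu]_x (dilation n g x * (rho x * w x ^+ 2)))).
  have [K1 hK1] := rho_bounded (tph n).
  have [K2 hK2] := rho_bounded (test_dilation n teta).
  have [K3 hK3] := rho_bounded (test_dilation n tg).
  rewrite -(Rint_add (integrableR_testM (test_dilation n teta) ikw) (integrableR_testM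
      (test_dilation n tg) irw)).
  pose psi (x : V) := (rho x * x ord0 i) * dilation n eta x.
  have dpsi x : partial i psi x = dilation n eta x * kappa x + dilation n g x * rho x.
    by have [_] := dW n x.
  have mpsi : measurable_fun setT psi.
    apply: measurable_funM; last by apply: test_measurable; exact: test_dilation.
    by apply: measurable_funM => //; exact: measurable_coord.
  have psiK x : `|psi x| <= K1 by have := hK1 x; rewrite /ph mulrA.
  have ddpsi x : derivable psi x (unit_vec i) by exact: (@ex_derive _ _ _ _ _ _ _ (dW n x)).
  have dpsiK x : `|partial i psi x| <= `|C| * K2 + K3.
    rewrite dpsi (le_trans (ler_normD _ _))// lerD//; last by rewrite mulrC.
    rewrite normrM; apply: (@le_trans _ _ (`|dilation n eta x| * (`|C| * `|rho x|))).
      apply: ler_wpM2l => //; apply: le_trans (kappa_le x) _.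
      by apply: ler_wpM2r => //; exact: ler_norm.
    rewrite mulrCA; apply: ler_wpM2l => //.
    by rewrite mulrC -normrM; exact: hK2.
  have := weight_identity A Lw mpsi psiK ddpsi dpsiK.
  rewrite (eq_Rint mu (f := fun x => psi x * (w x * G i x)) (g := fun x =>
      ph n x * (rho x * w x * G i x))); last first.
    by move=> x; rewrite /psi /ph; ring.
  move=> ->; congr (- (_ * _)); apply: eq_Rint => x; rewrite dpsi; ring.
have cL : (fun n => \sum_j \int[mu]_x (partial j (ph n) x * (G i x * G j x))
   - 2^-1 * \int[mu]_x (partial i (ph n) x * energy G x) + \int[mu]_x (partial i (ph n) x * e
       x)) @ \oo -->
  \sum_j ((i == j)%:R * \int[mu]_x (G i x * G j x)) - 2^-1 * ((i == i)%:R * \int[mu]_x energy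
      G x)
    + (i == i)%:R * \int[mu]_x e x.
  apply: cvgDn; last exact: partial_coord_dilation_cvg.
  apply: cvgBn; first by apply: cvg_sumR => j; exact: partial_coord_dilation_cvg.
  by apply: cvgMl_tmp; exact: partial_coord_dilation_cvg.
have cR : (fun n => 2^-1 * (\int[mu]_x (dilation n eta x * (kappa x * w x ^+ 2)) +
              \int[mu]_x (dilation n g x * (rho x * w x ^+ 2)))) @ \oo -->
   2^-1 * (eta 0 * \int[mu]_x (kappa x * w x ^+ 2) + g 0 * \int[mu]_x (rho x * w x ^+ 2)).
  by apply: cvgMl_tmp; apply: cvgDn; exact: dilation_cvg.
have E n : \sum_j \int[mu]_x (partial j (ph n) x * (G i x * G j x))
   - 2^-1 * \int[mu]_x (partial i (ph n) x * energy G x) + \int[mu]_x (partial i (ph n) x * e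
       x)
   = 2^-1 * (\int[mu]_x (dilation n eta x * (kappa x * w x ^+ 2)) +
              \int[mu]_x (dilation n g x * (rho x * w x ^+ 2))).
  rewrite -S -[X in _ + X]opprK -P -[RHS]opprK -W.
  rewrite -Rint_sub; [|exact: ifG|exact: ipG].
  rewrite -mulN1r -Rint_scale; last exact: irG.
  by apply: eq_Rint => x; rewrite fE; ring.
rewrite (funext E) in cL; have := cvg_unique (@Rhausdorff R) cL cR.
rewrite eqxx !mul1r eta0 mul1r /g [(0 : V) _ _]mxE !mul0r addr0 => <-.
congr (_ - _ + _); rewrite (bigD1 i)//= eqxx mul1r big1 ?addr0.
  by apply: eq_Rint => x; rewrite expr2.
by move=> j ji; rewrite eq_sym (negbTE ji) mul0r.
Qed.

End cutoff.

(** * The weight |x|^sigma *)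

Section derive_slices.
Context {R : realType} {N : nat}.
Local Notation V := 'rV[R]_N.
Implicit Types (u : V -> R) (x w : V).

Lemma is_derive_slice0 u x w (d : R) : is_derive (0 : R) (1 : R) (fun h : R => u (h *:
    w + x)) d ->
  is_derive x w u d.
Proof.
move=> [d1 e1]; split; first exact: (proj2 (derivable1P u x w) d1).
rewrite -[RHS]e1 /derive; set F := (fun h => _); set G := (X in _ = lim (X @ _)).
suff -> : F = G by []; apply/funext => h; rewrite /F /G /=.
by rewrite !addr0 scale0r add0r [h *: 1]mulr1.
Qed.

Lemma is_derive_comp u (f : R -> R) x w (d df : R) : is_derive x w u d ->
  is_derive (u x) (1 : R) f df -> is_derive x w (fun y => f (u y)) (df * d).
Proof.
move=> [du eu] hf; apply: is_derive_slice0.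
have hu : is_derive (0 : R) (1 : R) (fun h : R => u (h *: w + x)) d.
  have := @is_derive_slice _ _ u w x 0; rewrite scale0r add0r eu; exact.
apply: (@is_derive1_comp _ f (fun h : R => u (h *: w + x))) => //.
by rewrite scale0r add0r.
Qed.

End derive_slices.

Section weight.
Context {R : realType} {N : nat}.
Local Notation V := 'rV[R]_N.
Variables (sigma : R).
Hypothesis sigma_ge0 : 0 <= sigma.

Definition weight (x : V) : R := dotp x x `^ (sigma / 2).

Lemma dotp_ge0 (x : V) : 0 <= dotp x x.
Proof. by apply: sumr_ge0 => i _; rewrite -expr2 sqr_ge0. Qed.

Lemma coord_le_dotp (x : V) i : x ord0 i ^+ 2 <= dotp x x.
Proof.
rewrite /dotp (bigD1 i)//= -expr2 lerDl.
by apply: sumr_ge0 => j _; rewrite -expr2 sqr_ge0.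
Qed.

Lemma dotp_eq0 (x : V) : dotp x x = 0 -> x = 0.
Proof.
move=> x0; apply/rowP => i; rewrite mxE; apply/eqP; rewrite -sqrf_eq0.
by rewrite eq_le sqr_ge0 andbT -x0 coord_le_dotp.
Qed.

Lemma weightE (x : V) : enorm x `^ sigma = weight x.
Proof.
by rewrite /weight /enorm -powR12_sqrt ?dotp_ge0// -powRrM mulrC.
Qed.

Lemma weight_ge0 x : 0 <= weight x. Proof. exact: powR_ge0. Qed.

Lemma measurable_dotp : measurable_fun setT (fun x : V => dotp x x).
Proof.
apply: measurable_sum => i; apply: measurable_funM; exact: measurable_coord.
Qed.

Lemma measurable_dotp_powR (s : R) : measurable_fun setT (fun x : V => dotp x x `^ s).
Proof. exact: (measurableT_comp (measurable_powR s) measurable_dotp). Qed.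

Lemma measurable_weight : measurable_fun setT weight.
Proof. exact: measurable_dotp_powR. Qed.

Lemma dotp_le (x : V) : dotp x x <= N%:R * `|x| ^+ 2.
Proof.
rewrite /dotp; apply: (@le_trans _ _ (\sum_(i < N) `|x| ^+ 2)).
  apply: ler_sum => i _; rewrite -expr2 -real_normK ?num_real//.
  by rewrite lerXn2r ?nnegrE// coord_le_norm.
by rewrite sumr_const card_ord mulr_natl.
Qed.

Lemma weight_ge1 (x : V) i : 1 <= `|x ord0 i| -> 1 <= weight x.
Proof.
move=> xi; have x1 : 1 <= dotp x x.
  apply: le_trans (coord_le_dotp x i); rewrite -real_normK ?num_real//.
  by rewrite -(expr1n _ 2) lerXn2r ?nnegrE.
rewrite -(powRr0 (dotp x x)) /weight ler_powR//.
by rewrite divr_ge0.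
Qed.

Lemma weight_bounded (theta : V -> R) : test_function theta ->
  exists K, forall x, `|weight x * theta x| <= K.
Proof.
move=> tt; have [M M0 tM] := test_support tt; have [K K0 tK] := test_bounded tt.
exists ((N%:R * M ^+ 2) `^ (sigma / 2) * K) => x.
have [xM|Mx] := leP `|x| M; last by rewrite tM// mulr0 normr0 mulr_ge0 ?powR_ge0// ltW.
rewrite normrM ler_pM// (ger0_norm (weight_ge0 x)) /weight ge0_ler_powR//.
- by rewrite divr_ge0.
- by rewrite nnegrE dotp_ge0.
- by rewrite nnegrE mulr_ge0// sqr_ge0.
- apply: (le_trans (dotp_le x)); rewrite ler_wpM2l// lerXn2r ?nnegrE//; exact: ltW.
Qed.

(** The [i]-th partial derivative of [x_i |x|^sigma], since the second term is
[sigma x_i^2 |x|^(sigma-2)].  At the origin the factor [x_i^2] makes it vanish whatever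
the value of the power there. *)
Definition dweight (i : 'I_N) (x : V) : R :=
  weight x + sigma * x ord0 i ^+ 2 * dotp x x `^ (sigma / 2 - 1).

Lemma measurable_dweight i : measurable_fun setT (dweight i).
Proof.
apply: measurable_funD; first exact: measurable_weight.
apply: measurable_funM; last exact: measurable_dotp_powR.
apply: measurable_funM => //; apply: measurable_funX; exact: measurable_coord.
Qed.

Lemma dotp_powRB (x : V) : x != 0 ->
  dotp x x * dotp x x `^ (sigma / 2 - 1) = weight x.
Proof.
move=> x0; have d0 : dotp x x != 0 by apply: contra_neq x0; exact: dotp_eq0.
by rewrite powRB ?d0 ?implybT// powRr1 ?dotp_ge0// mulrCA mulfV// mulr1.
Qed.

(** Euler identity for the divergence of the homogeneous field [|x|^sigma x]. *)
Lemma sum_dweight x : \sum_i dweight i x = (N%:R + sigma) * weight x.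
Proof.
rewrite big_split /= sumr_const card_ord -mulr_suml -mulr_sumr.
have -> : \sum_i x ord0 i ^+ 2 = dotp x x by apply: eq_bigr => i _; rewrite expr2.
rewrite mulrDl mulr_natl; congr (_ + _).
have [->|x0] := eqVneq x 0; last by rewrite -mulrA dotp_powRB.
have d0 : dotp (0 : V) 0 = 0 by rewrite /dotp big1// => i _; rewrite mxE mul0r.
rewrite /weight d0 mulr0 mul0r.
have [->|s0] := eqVneq sigma 0; first by rewrite mul0r.
by rewrite powR0 ?mulr0// mulf_neq0// invr_neq0.
Qed.

Lemma dweight_le i x : `|dweight i x| <= (1 + sigma) * `|weight x|.
Proof.
rewrite mulrDl mul1r (le_trans (ler_normD _ _))// lerD2l.
rewrite -mulrA normrM (ger0_norm sigma_ge0) ler_wpM2l//.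
rewrite (ger0_norm (weight_ge0 x)) normrM !ger0_norm ?powR_ge0 ?sqr_ge0//.
have [->|x0] := eqVneq x 0; first by rewrite mxE expr0n mul0r weight_ge0.
by rewrite -dotp_powRB// ler_wpM2r ?powR_ge0// coord_le_dotp.
Qed.

Lemma is_derive_dotp i (x : V) : is_derive x (unit_vec i) (fun y : V =>
    dotp y y) (2 * x ord0 i).
Proof.
have -> : (fun y : V => dotp y y) = \sum_(j < N) (fun y : V => y ord0 j * y ord0 j).
  by apply/funext => y; rewrite fct_sumE.
have -> : 2 * x ord0 i = \sum_(j < N)
    (x ord0 j *: (unit_vec i : V) ord0 j + x ord0 j *: (unit_vec i : V) ord0 j).
  rewrite (bigD1 i)//= big1 => [|j ji].
    by rewrite /unit_vec mxE !eqxx /= addr0 [_ *: _]mulr1; ring.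
  by rewrite /unit_vec mxE eqxx /= (negbTE ji) scaler0 addr0.
apply: is_derive_sum => j; have hc := is_derive_coord x (unit_vec i) j.
exact: is_deriveM.
Qed.

(** Away from the origin this is the usual computation; at the origin the
difference quotient is [|h|^sigma]. *)
Lemma is_derive_weight i x : is_derive x (unit_vec i) (fun y : V =>
    weight y * y ord0 i) (dweight i x).
Proof.
have [x0|x0] := eqVneq x 0; last first.
  have d0 : 0 < dotp x x.
    by rewrite lt_neqAle dotp_ge0 eq_sym andbT; apply: contra_neq x0; exact: dotp_eq0.
  have hw := is_derive_comp (is_derive_dotp i x) (is_derive1_powR (sigma / 2) d0).
  have hc := is_derive_coord x (unit_vec i) i.
  have [dM eM] := is_deriveM hw hc; split => //; rewrite [LHS]eM.
  rewrite /dweight /unit_vec mxE !eqxx /= /weight.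
  by rewrite -![_ *: _]/(_ * _); field.
have [s0|s0] := eqVneq sigma 0.
  have wE : (fun y : V => weight y * y ord0 i) = (fun y : V => y ord0 i).
    by apply/funext => y; rewrite /weight s0 mul0r powRr0 mul1r.
  have -> : dweight i x = (unit_vec i : V) ord0 i.
    by rewrite /dweight /weight s0 !mul0r powRr0 addr0 /unit_vec mxE !eqxx.
  by rewrite wE; exact: is_derive_coord.
have sp : 0 < sigma by rewrite lt_neqAle eq_sym s0.
have dw0 : dweight i x = 0.
  have d0 : dotp x x = 0 by rewrite x0 /dotp big1// => j _; rewrite mxE mul0r.
  rewrite /dweight /weight d0 x0 mxE expr0n mulr0 mul0r addr0 powR0//.
  by rewrite mulf_neq0// invr_neq0.
have wh (h : R) : weight (h *: unit_vec i) = `|h| `^ sigma.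
  rewrite /weight; have -> : dotp (h *: unit_vec i : V) (h *: unit_vec i) = `|h| `^ 2.
    rewrite powR_mulrn// real_normK ?num_real// /dotp (bigD1 i)//= big1 => [|j ji].
      by rewrite !mxE !eqxx /= mulr1 addr0 expr2.
    by rewrite !mxE eqxx /= (negbTE ji) mulr0 mul0r.
  by rewrite -powRrM; congr (_ `^ _); field.
have c : (fun h : R => h^-1 *: (((fun y : V => weight y * y ord0 i) \o shift x) (h *:
    unit_vec i)
    - weight x * x ord0 i)) @ (0 : R)^' --> dweight i x.
  rewrite dw0; apply/cvgr0Pnorm_lt => e e0.
  have ep : 0 < e `^ sigma^-1 by rewrite powR_gt0.
  near=> h.
  have hn0 : h != 0 by near: h; exact: nbhs_dnbhs_neq.
  have he : `|h| < e `^ sigma^-1.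
    near: h; apply: dnbhs0_lt => //.
  rewrite /= x0 addr0 wh !mxE !eqxx /= mulr1 mulr0 subr0.
  rewrite [h^-1 *: _]mulrCA mulVf// mulr1 ger0_norm ?powR_ge0//.
  have -> : e = (e `^ sigma^-1) `^ sigma by rewrite -powRrM mulVf// powRr1// ltW.
  by rewrite gt0_ltr_powR// nnegrE// powR_ge0.
split; first by apply/cvg_ex; exists (dweight i x).
exact: cvg_lim.
Unshelve. all: by end_near. Qed.

End weight.

(** * The nonlinearity *)

Section powers.
Context {R : realType}.
Variable m : R.
Hypothesis m1 : 1 < m.
Let m0 : 0 < m. Proof. exact: lt_trans m1. Qed.
Let mp0 : 0 < m + 1. Proof. by rewrite addr_gt0. Qed.

Definition spow (a : R) := `|a| `^ (m - 1) * a.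

Lemma mul_spow a : a * spow a = `|a| `^ (m + 1).
Proof.
rewrite /spow; have [->|a0] := eqVneq a 0.
  by rewrite mul0r normr0 powR0// gt_eqF.
have -> : m + 1 = (m - 1) + 2 by ring.
rewrite (@powRD _ `|a| (m - 1) 2) ?normr_eq0 ?a0 ?implybT//.
by rewrite powR_mulrn// real_normK ?num_real//; ring.
Qed.

Lemma norm_spow a : `|spow a| = `|a| `^ m.
Proof.
rewrite /spow normrM (ger0_norm (powR_ge0 _ _)).
have [->|a0] := eqVneq a 0; first by rewrite normr0 mulr0 powR0// gt_eqF.
have -> : `|a| `^ m = `|a| `^ ((m - 1) + 1) by congr (_ `^ _); ring.
by rewrite (@powRD _ `|a| (m - 1) 1) ?normr_eq0 ?a0 ?implybT// powRr1.
Qed.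

Lemma spow_eq0 a : spow a = 0 -> a = 0.
Proof.
move=> a0; apply/normr0_eq0/(@powR_eq0_eq0 _ _ m).
by rewrite -norm_spow a0 normr0.
Qed.

(** As a function of [w = |v|^(m-1) v], the derivative of
[m/(m+1) |v|^(m+1)] is [v]; the convexity inequality is Young's inequality with
exponents [m+1] and [(m+1)/m]. *)
Lemma spow_subgradient a b : a * (spow b - spow a) <=
  m / (m + 1) * `|b| `^ (m + 1) - m / (m + 1) * `|a| `^ (m + 1).
Proof.
rewrite mulrBr mul_spow.
have h : a * spow b <= `|a| `^ (m + 1) / (m + 1) + (`|b| `^ m) `^ ((m + 1) / m) / ((m + 1) /
    m).
  apply: (@le_trans _ _ (`|a| * `|b| `^ m)).
    by rewrite -norm_spow -normrM ler_norm.
  apply: conjugate_powR; rewrite ?powR_ge0 ?divr_gt0//.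
  by field; rewrite !gt_eqF.
rewrite -powRrM in h.
have E : m * ((m + 1) / m) = m + 1 by field; rewrite gt_eqF.
rewrite E in h.
set X := `|a| `^ _ in h *; set Y := `|b| `^ _ in h *.
have -> : m / (m + 1) * Y - m / (m + 1) * X = X / (m + 1) + Y / ((m + 1) / m) - X.
  by field; rewrite !gt_eqF.
by rewrite lerD2r.
Qed.

Lemma sqr_le_powR a : a ^+ 2 <= 1 + `|a| `^ (m + 1).
Proof.
have p0 := powR_ge0 `|a| (m + 1); rewrite -real_normK ?num_real//.
have [a1|a1] := leP `|a| 1.
  by apply: (@le_trans _ _ 1); [rewrite expr_le1|rewrite lerDl].
apply: (@le_trans _ _ (`|a| `^ (m + 1))); last by rewrite lerDr.
rewrite -powR_mulrn//; apply: ler_powR; first exact: ltW.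
by move: m1; lra.
Qed.

End powers.

(** * Unpacking the function spaces *)

Section local_integrability.
Context {R : realType} {N : nat}.
Local Notation V := 'rV[R]_N.
Local Notation mu := (lebesgue_rV R N).
Implicit Types (u g : V -> R).

Lemma integrableR_locM u g K M : locally_integrable_rV u -> measurable_fun setT g ->
  (forall x, `|g x| <= K) -> (forall x, M < `|x| -> g x = 0) ->
  integrableR mu (fun x => u x * g x).
Proof.
move=> [mu' /(_ _ (@compact_norm_le R N M)) iu] mg gK gM.
have K0 : 0 <= K by exact: le_trans (gK 0).
have iB : integrableR mu (fun x => `|u x| * \1_[set x : V | `|x| <= M] x).
  apply/integrableP; split.
    apply/measurable_EFinP; apply: measurable_funM; first exact: measurableT_comp.
    by apply: measurable_indic; exact: measurable_norm_le.
  rewrite integral_mkcond in iu; apply: le_lt_trans iu.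
  rewrite le_eqVlt; apply/orP; left; apply/eqP; apply: eq_integral => x _ /=.
  rewrite /patch indicE; case: (x \in _) => /=; last by rewrite mulr0 normr0.
  by rewrite mulr1 normr_id.
apply: (le_integrableR _ (integrableRZ K iB)); first exact: measurable_funM.
move=> x; rewrite normrM indicE; have [xM|Mx] := leP `|x| M.
  by rewrite mem_set// mulr1 mulrC; apply: ler_wpM2r.
by rewrite gM// normr0 mulr0 mulr_ge0// mulr_ge0.
Qed.

Lemma integrableR_loc_test u theta : locally_integrable_rV u -> test_function theta ->
  integrableR mu (fun x => u x * theta x).
Proof.
move=> lu tt; have [K _ tK] := test_bounded tt; have [M _ tM] := test_support tt.
exact: (integrableR_locM lu (test_measurable tt) tK tM).
Qed.

(** The weak gradient of the stationary solution and the one of the approximating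
sequence are chosen independently; they are only compared through their pairings. *)
Lemma weak_gradient_eq u (G H : V -> V) theta j : weak_gradient u G -> weak_gradient u H ->
  test_function theta ->
  \int[mu]_x (G x ord0 j * theta x) = \int[mu]_x (H x ord0 j * theta x).
Proof.
move=> [_ _ hG] [_ _ hH] tt; apply: oppr_inj.
by rewrite -(hG theta j tt) -(hH theta j tt).
Qed.

Lemma Lnorm2_enorm (H : V -> V) :
  ('N[mu]_2%:E[EFin \o (fun x => enorm (H x))] `^ 2 = \int[mu]_x (dotp (H x) (H x))%:E)%E.
Proof.
rewrite poweR_Lnorm//; apply: eq_integral => x _ /=.
congr EFin.
rewrite ger0_norm ?sqrtr_ge0// powR_mulrn ?sqrtr_ge0// sqr_sqrtr//.
exact: dotp_ge0.
Qed.

Lemma integrableR_dotp (H : V -> V) : (forall j, measurable_fun setT (fun x => H x ord0 j)) ->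
  ('N[mu]_2%:E[EFin \o (fun x => enorm (H x))] < +oo)%E ->
  integrableR mu (fun x => dotp (H x) (H x)).
Proof.
move=> mH H2; apply/integrableP; split.
  apply/measurable_EFinP; apply: measurable_sum => j; exact: measurable_funM.
rewrite (eq_integral (fun x => (dotp (H x) (H x))%:E)); last first.
  by move=> x _ /=; rewrite ger0_norm// dotp_ge0.
rewrite -Lnorm2_enorm; exact: poweR_lty.
Qed.

Lemma L2_coord (H : V -> V) j : (forall j, measurable_fun setT (fun x => H x ord0 j)) ->
  integrableR mu (fun x => dotp (H x) (H x)) -> L2 mu (fun x => H x ord0 j).
Proof.
move=> mH iH; split => //; apply: (le_integrableR _ iH); first exact: measurable_funX.
by move=> x; rewrite ger0_norm ?sqr_ge0// coord_le_dotp.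
Qed.

End local_integrability.

Section approx.
Context {R : realType} {N : nat}.
Local Notation V := 'rV[R]_N.
Local Notation mu := (lebesgue_rV R N).

Lemma Hdot1_approximable (w : V -> R) : Hdot1 w ->
  exists G phi, weak_gradient w G /\ approximable w (fun j x => G x ord0 j) phi.
Proof.
move=> [G wG [Gfin [phi [tphi cG cw]]]]; exists G, phi; split => //.
have [[mw _] lG _] := wG.
have mG j : measurable_fun setT (fun x => G x ord0 j) by case: (lG j).
have iG := integrableR_dotp mG Gfin.
have LG j : L2 mu (fun x => G x ord0 j) by exact: L2_coord.
split => //.
- move=> j; pose H k x := gradient (phi k) x - G x.
  have HE k i x : H k x ord0 i = partial i (phi k) x - G x ord0 i by rewrite !mxE.
  have LH k i : L2 mu (fun x => H k x ord0 i).
    under [X in L2 _ X]eq_fun do rewrite HE.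
    by apply: L2B => //; apply: L2_test; exact: test_partial.
  have iH k : integrableR mu (fun x => dotp (H k x) (H k x)).
    by apply: integrableR_sum => i; exact: L2M.
  have nE k : ('N[mu]_2%:E[EFin \o (fun x => enorm (H k x))] `^ 2 =
      (\int[mu]_x dotp (H k x) (H k x))%:E)%E.
    rewrite Lnorm2_enorm /Rintegral fineK//; exact: integrable_fin_num (iH k).
  have c0 : (fun k => fine ('N[mu]_2%:E[EFin \o (fun x => enorm (H k x))])%E) @ \oo --> 0.
    exact: fine_cvg cG.
  have c1 : (fun k => fine ('N[mu]_2%:E[EFin \o (fun x => enorm (H k x))])%E ^+ 2) @ \oo --> 0.
    rewrite -(mulr0 0); under eq_fun do rewrite expr2; exact: cvgM.
  apply: (squeeze0 _ _ c1).
    by move=> k; apply: Rint_ge0 => x; exact: sqr_ge0.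
  move=> k; have -> : fine ('N[mu]_2%:E[EFin \o (fun x => enorm (H k x))])%E ^+ 2 =
      \int[mu]_x dotp (H k x) (H k x).
    have := nE k; case: ('N[mu]_2%:E[_])%E (Lnorm_ge0 mu 2%:E (EFin \o (fun x =>
        enorm (H k x)))) => [r r0|//|//].
    + by rewrite poweR_EFin => -[<-]; rewrite powR_mulrn.
    + by rewrite poweRyr.
  apply: le_Rint => //; first by have [_] := LH k j;
      under [X in integrableR _ X]eq_fun do rewrite HE.
  by move=> x; rewrite -HE coord_le_dotp.
- move=> M; have c := cw _ (@compact_norm_le R N M).
  have E k : (\int[mu]_x (`|phi k x - w x| * \1_[set x : V | `|x| <= M] x)%:E =
      \int[mu]_(x in [set x : V | (`|x| <= M)%R]) (`|phi k x - w x|)%:E)%E.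
    rewrite [RHS]integral_mkcond; apply: eq_integral => x _.
    by rewrite /patch indicE; case: (x \in _); rewrite ?mulr1 ?mulr0.
  by rewrite (funext E).
Qed.

End approx.

(** * Conclusion *)

Section main.
Context {R : realType} {N : nat}.
Local Notation V := 'rV[R]_N.
Local Notation mu := (lebesgue_rV R N).

Lemma cvg_cst_eq (a b : R) : (fun _ : nat => a) @ \oo --> b -> b = a.
Proof. by move=> c; rewrite -(cvg_lim (@Rhausdorff R) c) lim_cst. Qed.

(** Since [w] equals its translate, the integral of [psi w^2] is the pairing of
[psi w] with a translate of [w] as far away as desired. *)
Lemma translation_invariant_null (w eta : V -> R) (i : 'I_N) : test_function eta ->
    eta 0 = 1 -> L2 mu w ->
  (forall h : R, \int[mu]_x (shift_diff i h w x ^+ 2) = 0) -> \int[mu]_x (w x ^+ 2) = 0.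
Proof.
move=> teta eta0 Lw D0.
have Lw2 : integrableR mu (fun x => w x ^+ 2) by case: Lw.
have z n : \int[mu]_x (dilation n eta x * w x ^+ 2) = 0.
  have td := test_dilation n teta; have [M _ dM] := test_support td.
  have Lg : L2 mu (fun x => dilation n eta x * w x) by exact: L2_testM.
  have gM x : M < `|x| -> dilation n eta x * w x = 0 by move=> Mx; rewrite dM// mul0r.
  have c := @pairing_far_translate_cvg0 _ _ M _ w i gM Lg Lw.
  have E (k : nat) : \int[mu]_x (w (x + k%:R *: unit_vec i) * (dilation n eta x * w x)) =
      \int[mu]_x (dilation n eta x * w x ^+ 2).
    have LD := L2_shift_diff i k%:R Lw.
    have D1 : \int[mu]_x (shift_diff i k%:R w x * (dilation n eta x * w x)) = 0.
      apply/eqP; rewrite -sqrf_eq0 eq_le sqr_ge0 andbT.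
      by apply: le_trans (cauchy_schwarz LD Lg) _; rewrite D0 mul0r.
    rewrite -[RHS]add0r -D1 -Rint_add; [|exact: L2M|exact: integrableR_testM].
    by apply: eq_Rint => x; rewrite /shift_diff; ring.
  rewrite (funext E) in c.
  by rewrite (cvg_cst_eq c).
have c := dilation_cvg teta Lw2; rewrite (funext z) eta0 mul1r in c.
exact: cvg_cst_eq c.
Qed.

Lemma int_sqr_eq0 (w : V -> R) : L2 mu w -> \int[mu]_x (w x ^+ 2) = 0 ->
  {ae mu, forall x, w x = 0}.
Proof.
move=> [mw iw] w0.
have : (\int[mu]_x `|(w x ^+ 2)%:E| = 0)%E.
  rewrite (eq_integral (fun x => (w x ^+ 2)%:E)); last first.
    by move=> x _ /=; rewrite ger0_norm ?sqr_ge0.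
  have := integrable_fin_num measurableT iw => /fineK <- /=.
  by congr (_%:E).
have m2 : measurable_fun setT (fun x => (w x ^+ 2)%:E).
  by apply/measurable_EFinP; exact: measurable_funX.
move=> /(ae_eq_integral_abs mu measurableT m2); apply: filterS => x /(_ Logic.I) /=.
by move=> [] /eqP; rewrite sqrf_eq0 => /eqP.
Qed.

(** The approximating sequence itself provides cutoffs: some [phi k] is nonzero
at some point, and then translating, normalizing and squaring it gives a nonnegative
test function equal to 1 at the origin. *)
Lemma approximable_cutoff (w : V -> R) (G : 'I_N -> V -> R) phi : approximable w G phi ->
  (L2 mu w /\ \int[mu]_x (w x ^+ 2) = 0) \/
  exists eta : V -> R, [/\ test_function eta, forall x, 0 <= eta x & eta 0 = 1].
Proof.
move=> A; have tphi := appr_test A.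
have [[k [x0 kx]]|h] := pselect (exists k x, phi k x != 0); [right|left].
  pose g x := (phi k x0)^-1 * phi k (x + x0).
  have tg : test_function g by apply: test_scale; apply: test_shift; exact: tphi.
  exists (fun x => g x * g x); split.
  - by apply: test_mul => //; exact: test_smooth.
  - by move=> x; rewrite -expr2 sqr_ge0.
  - by rewrite /g add0r mulVf// mulr1.
have z k x : phi k x = 0.
  by apply: contrapT => /eqP kx; apply: h; exists k, x.
have Lphi k : L2 mu (phi k) by exact: L2_test.
have Iphi k : \int[mu]_x (phi k x ^+ 2) <= 0.
  by rewrite (eq_Rint mu (g := fun=> 0)) ?Rint0// => x; rewrite z expr0n.
have [Lw w0] := @L2_lower_semicontinuity _ _ phi w (fun=>
    0) 0 Lphi (appr_meas A) (appr_loc A) Iphi (cvg_cst 0).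
split => //; apply/eqP; rewrite eq_le w0; apply: Rint_ge0 => x; exact: sqr_ge0.
Qed.

(** The weight is at least 1 outside the unit cube; inside, [w] is compared with
its translate by [3 e_i], which lies outside, through the square integrable increment. *)
Lemma L2_of_weighted (w : V -> R) (G : 'I_N -> V -> R) phi sigma (i : 'I_N) : 0 <= sigma ->
    approximable w G phi ->
  integrableR mu (fun x => weight sigma x * w x ^+ 2) -> L2 mu w.
Proof.
move=> s0 A irw; have mw := appr_meas A; split => //.
(* A point of the unit cube moved by [3 e_i] has [i]-th coordinate at least 2. *)
pose h : V := 3 *: unit_vec i.
have LD := L2_shift_diff_limit A i 3.
have irh := integrableR_shift h irw.
apply: (le_integrableR _ (integrableRD irw (integrableRD (integrableRZ 2 irh) (integrableRZ 2
    (proj2 LD))))).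
  exact: measurable_funX.
move=> x; rewrite ger0_norm ?sqr_ge0//.
have r0 y : 0 <= weight sigma y * w y ^+ 2 by rewrite mulr_ge0 ?weight_ge0 ?sqr_ge0.
have d0 : 0 <= shift_diff i 3 w x ^+ 2 by exact: sqr_ge0.
have [x1|x1] := leP `|x| 1.
  have w1 : 1 <= weight sigma (x + h).
    apply: (@weight_ge1 _ _ _ s0 _ i).
    have xi : `|x ord0 i| <= 1 by apply: le_trans (coord_le_norm x i) x1.
    have -> : (x + h) ord0 i = x ord0 i + 3.
      by rewrite !mxE !eqxx /= mulr1.
    by move: xi; rewrite !ler_norml ler_normr => /andP[? ?]; apply/orP; left; lra.
  have hw : w (x + h) ^+ 2 <= weight sigma (x + h) * w (x + h) ^+ 2.
    by rewrite ler_peMl ?sqr_ge0.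
  apply: (@le_trans _ _ (2 * w (x + h) ^+ 2 + 2 * shift_diff i 3 w x ^+ 2)).
    rewrite /shift_diff -/h; have := sqr_ge0 (w (x + h) + (w (x + h) - w x)); nra.
  by have := r0 x; lra.
have [j xj] : exists j, 1 <= `|x ord0 j|.
  apply: contrapT => hn; move: x1; apply/negP; rewrite -leNgt.
  apply: norm_leP => // j; rewrite leNgt; apply/negP => xj; apply: hn; exists j; exact: ltW.
have w1 := weight_ge1 s0 xj.
have hw : w x ^+ 2 <= weight sigma x * w x ^+ 2 by rewrite ler_peMl ?sqr_ge0.
have := r0 (x + h); lra.
Qed.

End main.

Section conclusion.
Context {R : realType} {N : nat}.
Local Notation V := 'rV[R]_N.
Local Notation mu := (lebesgue_rV R N).
Variables (m sigma : R).
Hypothesis m1 : 1 < m.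
Hypothesis s0 : 0 <= sigma.
Hypothesis hs : sigma <= sigma0 N m.

Lemma stationary_null (v : V -> R) (i0 : 'I_N) : stationary_solution m sigma v ->
  {ae mu, forall x, v x = 0}.
Proof.
move=> [[vL [wH wS]] [G1 wG1 weak]].
have mp0 : 0 < m + 1 by rewrite addr_gt0// (lt_trans ltr01).
have wE x : signed_pow m v x = spow m (v x) by [].
set w := signed_pow m v in wH wS wG1 weak.
have [mv ivm] : measurable_fun setT v /\ integrableR mu (fun x => `|v x| `^ (m + 1)).
  split; first by move: vL; rewrite inE => /andP[]; rewrite inE.
  by apply: Lfun_integrable vL; move: m1; lra.
have [G [phi [wG A]]] := Hdot1_approximable wH.
have mw := appr_meas A.
have irw : integrableR mu (fun x => weight sigma x * w x ^+ 2).
  have [_ fin] := wS; apply/integrableP; split.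
    apply/measurable_EFinP; apply: measurable_funM; first exact: measurable_weight.
    exact: measurable_funX.
  apply: le_lt_trans fin; rewrite le_eqVlt; apply/orP; left; apply/eqP.
  apply: eq_integral => x _ /=; rewrite weightE real_normK ?num_real//.
  by rewrite ger0_norm// mulr_ge0 ?weight_ge0 ?sqr_ge0.
have Lw := L2_of_weighted i0 s0 A irw.
suff w0 : \int[mu]_x (w x ^+ 2) = 0.
  have := int_sqr_eq0 Lw w0; apply: filterS => x; rewrite /w wE; exact: spow_eq0.
have [[_ //]|[eta [teta eta_ge0 eta0]]] := approximable_cutoff A.
pose f x := v x - weight sigma x * w x.
have Lv theta : test_function theta -> L2 mu (fun x => v x * theta x).
  move=> tt; have [K K0 tK] := test_bounded tt; have tt2 := test_mul (test_smooth tt) tt.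
  split; first by apply: measurable_funM => //; exact: test_measurable.
  have i1 := integrableRD (integrableR_test tt2) (integrableR_testM tt2 ivm).
  apply: (le_integrableR _ i1); first by apply: measurable_funX; apply: measurable_funM =>
      //; exact: test_measurable.
  move=> x; rewrite ger0_norm ?sqr_ge0// exprMn mulrC -expr2.
  rewrite -[X in X + _]mulr1 -mulrDr; apply: ler_wpM2l; first exact: sqr_ge0.
  exact: sqr_le_powR.
have weq theta : test_function theta ->
    \sum_j \int[mu]_x (G x ord0 j * partial j theta x) = \int[mu]_x (f x * theta x).
  move=> tt; have wt := weak _ tt.
  have iG1 j : integrableR mu (fun x => G1 x ord0 j * partial j theta x).
    by have [_ lG _] := wG1; apply: integrableR_loc_test => //; exact: test_partial.
  have [K tK] := weight_bounded s0 tt; have [M _ tM] := test_support tt.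
  have irt : integrableR mu (fun x => weight sigma x * w x * theta x).
    have [lw _ _] := wG1.
    have := @integrableR_locM _ _ w (fun x => weight sigma x * theta x) K M lw _ tK _.
    under [X in integrableR _ X]eq_fun do rewrite mulrCA mulrA.
    apply; first by apply: measurable_funM; [exact: measurable_weight|exact: test_measurable].
    by move=> x Mx; rewrite tM// mulr0.
  have ivt : integrableR mu (fun x => v x * theta x).
    apply: (le_integrableR _ (integrableRD (proj2 (Lv _ tt)) (integrableR_ball M))).
      by apply: measurable_funM => //; exact: test_measurable.
    move=> x; rewrite indicE; have [xM|Mx] := leP `|x| M; last first.
      by rewrite tM// mulr0 normr0 expr0n add0r.
    rewrite mem_set//=; set a := v x * theta x.
    rewrite -[X in X + _]real_normK ?num_real//; have := sqr_ge0 (`|a| - 1); nra.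
  have {}wt : \int[mu]_x (\sum_j G1 x ord0 j * partial j theta x + weight sigma x * w x *
      theta x) =
      \int[mu]_x (v x * theta x).
    rewrite -wt; apply: eq_Rint => x; rewrite weightE; congr (_ + _).
    by apply: eq_bigr => j _; rewrite mxE.
  rewrite (Rint_add (integrableR_sum _ iG1) irt) in wt.
  transitivity (\int[mu]_x (v x * theta x) - \int[mu]_x (weight sigma x * w x * theta x));
      last first.
    by rewrite -Rint_sub//; apply: eq_Rint => x; rewrite /f; ring.
  rewrite -wt addrK Rint_sum//; apply: eq_bigr => j _.
  by apply: (weak_gradient_eq (u := w)) => //; exact: test_partial.
have vwE x : v x * w x = `|v x| `^ (m + 1) by rewrite /w wE mul_spow.
have ivw : integrableR mu (fun x => v x * w x).
  by under [X in integrableR _ X]eq_fun do rewrite vwE.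
pose e x := m / (m + 1) * `|v x| `^ (m + 1).
have ie : integrableR mu e by exact: integrableRZ.
have conv x y : v x * (w y - w x) <= e y - e x by rewrite /w !wE; exact: spow_subgradient.
have fE x : f x = v x - weight sigma x * w x by [].
have mrho := @measurable_weight R N sigma.
have EI := energy_identity teta eta0 A Lw weq fE Lv mrho (fun t =>
    weight_bounded s0 (theta := t)) irw ivw i0.
have VI i := virial_identity teta eta_ge0 eta0 A Lw weq fE Lv mrho (fun t =>
    weight_bounded s0 (theta := t)) irw ie conv
   (is_derive_weight s0 i) (dweight_le s0 i) (measurable_dweight sigma i).
have mdw i := measurable_dweight sigma i.
have ikw i : integrableR mu (fun x => dweight sigma i x * w x ^+ 2).
  apply: (le_integrableR _ (integrableRZ (1 + sigma) irw)).
    by apply: measurable_funM; [exact: mdw|exact: measurable_funX].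
  move=> x; rewrite normrM mulrA [X in _ * X <= _]ger0_norm ?sqr_ge0//.
  apply: ler_wpM2r; first exact: sqr_ge0.
  by have := dweight_le s0 i x; rewrite (ger0_norm (weight_ge0 _ _)).
pose Gc (j : 'I_N) x := G x ord0 j.
have LG j : integrableR mu (fun x => Gc j x ^+ 2) by case: (appr_grad A j).
set AA := \int[mu]_x energy _ x in EI VI.
set BB := \int[mu]_x (weight sigma x * w x ^+ 2) in EI.
set CC := \int[mu]_x (v x * w x) in EI.
have eI : \int[mu]_x e x = m / (m + 1) * CC.
  rewrite /CC -Rint_scale//; apply: eq_Rint => x; by rewrite vwE.
have AE : AA = \sum_i \int[mu]_x (Gc i x ^+ 2) by rewrite /AA -Rint_sum.
have BE : \sum_i \int[mu]_x (dweight sigma i x * w x ^+ 2) = (N%:R + sigma) * BB.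
  rewrite -Rint_sum// /BB -Rint_scale//; apply: eq_Rint => x.
  by rewrite -mulr_suml sum_dweight mulrA.
have key : AA - N%:R * (2^-1 * AA) + N%:R * (m / (m + 1) * CC) = 2^-1 * ((N%:R + sigma) * BB).
  rewrite -BE mulr_sumr -(eq_bigr _ (fun i _ => VI i)) big_split sumrB /=.
  by rewrite -AE !sumr_const card_ord eI !mulr_natl.
have A0 : 0 <= AA.
  by apply: Rint_ge0 => x; apply: sumr_ge0 => j _; exact: sqr_ge0.
have B0 : 0 <= BB by apply: Rint_ge0 => x; rewrite mulr_ge0 ?weight_ge0 ?sqr_ge0.
(* The virial identity multiplied by [2 (m + 1)], after substituting [C = A + B]. *)
have key2 : AA * (2 * (m + 1) + N%:R * (m - 1)) = BB * (sigma * (m + 1) - N%:R * (m - 1)).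
  have CE : CC = AA + BB by rewrite EI subrK.
  have {}key : 2 * (m + 1) * (AA - N%:R * (2^-1 * AA) + N%:R * (m / (m + 1) * CC)) =
    2 * (m + 1) * (2^-1 * ((N%:R + sigma) * BB)) by rewrite key.
  have m10 : m + 1 != 0 by rewrite gt_eqF.
  have e1 : 2 * (m + 1) * (AA - N%:R * (2^-1 * AA) + N%:R * (m / (m + 1) * CC)) =
    2 * (m + 1) * AA - N%:R * (m + 1) * AA + 2 * N%:R * m * CC by field.
  have e2 : 2 * (m + 1) * (2^-1 * ((N%:R + sigma) * BB)) = (m + 1) * (N%:R + sigma) * BB by
      field.
  rewrite e1 e2 CE in key.
  apply/eqP; rewrite -subr_eq0; apply/eqP.
  transitivity ((2 * (m + 1) * AA - N%:R * (m + 1) * AA + 2 * N%:R * m * (AA + BB)) - (m + 1)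
      * (N%:R + sigma) * BB).
    by ring.
  by rewrite key subrr.
have hsN : sigma * (m + 1) - N%:R * (m - 1) <= 0.
  by move: hs; rewrite /sigma0 ler_pdivlMr// subr_le0.
have AA0 : AA = 0.
  apply/eqP; rewrite eq_le A0 andbT.
  have p : 0 < 2 * (m + 1) + N%:R * (m - 1).
    by rewrite ltr_pwDl ?mulr_gt0// mulr_ge0// subr_ge0 ltW.
  by rewrite -(pmulr_lle0 _ p) key2 mulr_ge0_le0.
have Gi0 : \int[mu]_x (Gc i0 x ^+ 2) = 0.
  apply/eqP; rewrite eq_le -{1}AA0 AE (bigD1 i0)//= lerDl.
  apply/andP; split; last by apply: Rint_ge0 => x; exact: sqr_ge0.
  by apply: sumr_ge0 => j _; apply: Rint_ge0 => x; exact: sqr_ge0.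
apply: (translation_invariant_null (i := i0) teta eta0 Lw) => h.
apply/eqP; rewrite eq_le; apply/andP; split; last by apply: Rint_ge0 => x; exact: sqr_ge0.
by apply: le_trans (norm_diff_limit A i0 h) _; rewrite Gi0 mulr0.
Qed.

End conclusion.

Unset Implicit Arguments.

Theorem proposition1p4 (R : realType) (N : nat) (hN : (1 <= N)%N) (m : R)
    (hm : 1 < m) (sigma : R) (hsigma : 0 <= sigma <= sigma0 N m) :
  ~ exists v : 'rV[R]_N -> R, stationary_solution m sigma v /\ nontrivial v.
Proof.
move=> [v [sv nv]]; have /andP[s0 hs] := hsigma.
have v0 := stationary_null hm s0 hs (Ordinal hN) sv.
exact: nv v0.
Qed.
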